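(* Let $\mathcal{G}$ be a graph class such that either every graph in $\mathcal{G}$ is a unit disk graph, or every graph in $\mathcal{G}$ has sign-rank at most $3$. Then $\mathsf{R}(\mathcal{G}) = O(1)$ if and only if $\mathcal{G}$ is stable. As a consequence, every stable class of unit disk graphs and every stable class of graphs of sign-rank at most $3$ admits an implicit representation.
   Context: A graph class is a set of labeled graphs closed under isomorphism. A graph $G$ is a unit disk graph if there is a map $\phi: V(G)\to\mathbb{R}^2$ with $xy\in E(G)$ iff $\|\phi(x)-\phi(y)\|_2<2$. Sign-rank: for $M\in\{\pm1\}^{X\times Y}$, $\mathrm{rank}_\pm(M)$ is the minimum rank of a real matrix $R$ with all entries nonzero and $M_{x,y}=\mathrm{sign}(R_{x,y})$ for all $x,y$. For a bipartite graph $G=(X,Y,E)$ with fixed bipartition, its sign-rank is that of its bipartite adjacency matrix $\mathrm{Adj}_G\in\{\pm1\}^{X\times Y}$ ($\mathrm{Adj}_G(x,y)=1$ iff $xy\in E$). For a general graph $G=(V,E)$, its sign-rank is the minimum rank of a real matrix $R\in\mathbb{R}^{V\times V}$ such that for all $i\neq j$, $\mathrm{sign}(R_{i,j})=1$ if $ij\in E$ and $-1$ otherwise (no condition on diagonal entries). Communication: for $M\in\{\pm1\}^{X\times Y}$, $\mathsf{R}(M)$ is the two-way public-coin randomized communication complexity of $M$ with success probability at least $2/3$ on every input (Alice holds $x$, Bob holds $y$, they must output $M(x,y)$; cost is worst-case number of bits communicated). For a graph class, $\mathsf{R}(\mathcal{G})$ is the function $N\mapsto\max\{\mathsf{R}(\mathrm{Adj}_G):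 G\in\mathcal{G}$ has $N$ vertices$\}$, where $\mathrm{Adj}_G\in\{\pm1\}^{V\times V}$ is the adjacency matrix ($\mathrm{Adj}_G(x,y)=1$ iff $xy\in E$), or the bipartite adjacency matrix if $\mathcal{G}$ is a class of bipartite graphs with fixed bipartitions. $\mathsf{R}(\mathcal{G})=O(1)$ means this function is bounded by a constant. Chain-index $\mathrm{ch}(G)$: the largest $k$ such that there are $2k$ distinct vertices $a_1,\dots,a_k,b_1,\dots,b_k$ of $G$ with, for all $i<j$, $a_i b_j\in E(G)$ and $b_i a_j\notin E(G)$. A class $\mathcal{G}$ is stable if there is a constant $k$ with $\mathrm{ch}(G)\le k$ for all $G\in\mathcal{G}$. Implicit representation: a class $\mathcal{G}$ admits one if there exist a decoder $D:\{0,1\}^*\times\{0,1\}^*\to\{0,1\}$ and a constant $c$ such that for every $N$-vertex $G\in\mathcal{G}$ there is an encoding $\mathrm{enc}:V(G)\to\{0,1\}^*$ with $|\mathrm{enc}(v)|\le c\log N$ (for $N\ge2$) and $D(\mathrm{enc}(u),\mathrm{enc}(v))=1$ iff $uv\in E(G)$, for all $u,v$. *)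

(* Defs.v *)
From HB Require Import structures.
From mathcomp Require Import all_boot all_order all_fingroup all_algebra.
From mathcomp Require Import boolp reals exp.

Set Implicit Arguments.
Unset Strict Implicit.
Unset Printing Implicit Defensive.

Import Order.TTheory GRing.Theory Num.Theory.

Local Open Scope ring_scope.

(* Sign matrices with entries in {-1, 1} are encoded as boolean matrices,
   [true] standing for 1 and [false] for -1. In particular the adjacency matrix
   of a graph, as a sign matrix, is its boolean adjacency matrix. *)

Definition simple_adj n (A : 'M[bool]_n) : bool :=
  [forall x, forall y, A x y == A y x] && [forall x, ~~ A x x].

Record sgraph n := SGraph { adj : 'M[bool]_n; _ : simple_adj adj }.
HB.instance Definition _ n := [isSub for @adj n].
HB.instance Definition _ n := [Finite of sgraph n by <:].

Definition edge n (G : sgraph n) : rel 'I_n := fun x y => adj G x y.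

Definition isomorphic n (G H : sgraph n) : Prop :=
  exists s : 'S_n, forall x y, edge H (s x) (s y) = edge G x y.

Record graph_class := GraphClass {
  class_graphs :> forall n, {set sgraph n};
  class_iso : forall n (G H : sgraph n),
    isomorphic G H -> G \in class_graphs n -> H \in class_graphs n }.

(* A bipartite graph (X, Y, E) with fixed bipartition, X = 'I_m and Y = 'I_n,
   is given by its bipartite adjacency matrix. *)
Definition bigraph m n := 'M[bool]_(m, n).

Definition biedge m n (G : bigraph m n) : rel ('I_m + 'I_n) := fun u v =>
  match u, v with
  | inl x, inr y => G x y
  | inr y, inl x => G x y
  | _, _ => false
  end.

Definition biisomorphic m n (G H : bigraph m n) : Prop :=
  exists (s : 'S_m) (t : 'S_n), forall x y, H (s x) (t y) = G x y.

Record bigraph_class := BigraphClass {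
  biclass_graphs :> forall m n, {set 'M[bool]_(m, n)};
  biclass_iso : forall m n (G H : bigraph m n),
    biisomorphic G H -> G \in biclass_graphs m n -> H \in biclass_graphs m n }.

(* The library norm on ['rV[R]_n] is the sup norm, hence this definition. *)
Definition norm2 (R : realType) n (v : 'rV[R]_n) : R :=
  Num.sqrt (\sum_i v 0 i ^+ 2).

(* Graphs have no loops, so only pairs of distinct vertices are constrained;
   [phi] need not be injective. *)
Definition unit_disk (R : realType) (V : finType) (e : rel V) : Prop :=
  exists phi : V -> 'rV[R]_2,
    forall x y, x != y -> e x y = (norm2 (phi x - phi y) < 2).

Section SignRank.
Variable R : realType.

Definition pm1 (b : bool) : R := if b then 1 else -1.

Definition sign_represents m n (M : 'M[bool]_(m, n)) (A : 'M[R]_(m, n)) : Prop :=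
  forall x y, Num.sg (A x y) = pm1 (M x y).

Definition sign_represents_offdiag n (G : sgraph n) (A : 'M[R]_n) : Prop :=
  forall x y, x != y -> Num.sg (A x y) = pm1 (edge G x y).

Lemma sg_pm1 b : Num.sg (pm1 b) = pm1 b.
Proof. by case: b; rewrite /pm1 ?sgrN sgr1. Qed.

Lemma bisign_rank_subproof m n (M : 'M[bool]_(m, n)) :
  exists r, `[< exists A : 'M[R]_(m, n), sign_represents M A /\ \rank A = r >].
Proof.
exists (\rank (map_mx pm1 M)); apply/asboolP; exists (map_mx pm1 M); split=> //.
by move=> x y; rewrite mxE sg_pm1.
Qed.

Lemma sign_rank_subproof n (G : sgraph n) :
  exists r, `[< exists A : 'M[R]_n, sign_represents_offdiag G A /\ \rank A = r >].
Proof.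
exists (\rank (map_mx pm1 (adj G))); apply/asboolP.
by exists (map_mx pm1 (adj G)); split=> // x y _; rewrite mxE sg_pm1.
Qed.

Definition bisign_rank m n (M : 'M[bool]_(m, n)) : nat :=
  ex_minn (bisign_rank_subproof M).

Definition sign_rank n (G : sgraph n) : nat := ex_minn (sign_rank_subproof G).

End SignRank.

(* Deterministic two-way protocol trees: at a node [Alice f p0 p1] Alice, who
   holds x, sends the bit [f x] and the players continue with [p1] if that bit
   is 1 and with [p0] if it is 0; similarly for [Bob]. *)
Inductive protocol (X Y : Type) : Type :=
| Output of bool
| Alice of (X -> bool) & protocol X Y & protocol X Y
| Bob of (Y -> bool) & protocol X Y & protocol X Y.

Arguments Output {X Y}.

Fixpoint run X Y (p : protocol X Y) (x : X) (y : Y) : bool :=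
  match p with
  | Output b => b
  | Alice f p0 p1 => if f x then run p1 x y else run p0 x y
  | Bob f p0 p1 => if f y then run p1 x y else run p0 x y
  end.

Fixpoint cost X Y (p : protocol X Y) : nat :=
  match p with
  | Output _ => 0
  | Alice _ p0 p1 => (maxn (cost p0) (cost p1)).+1
  | Bob _ p0 p1 => (maxn (cost p0) (cost p1)).+1
  end.

Section RandomizedCC.
Variable R : realType.

(* A public-coin protocol is a probability distribution over deterministic
   protocols. As the inputs range over finite sets there are, up to
   extensional equality, finitely many protocols of bounded cost, so that
   finite probability spaces are fully general. *)
Definition randomized_protocol_of_cost m n (M : 'M[bool]_(m, n)) (c : nat) : Prop :=
  exists (Omega : finType) (mu : Omega -> R) (P : Omega -> protocol 'I_m 'I_n),
    [/\ forall w, 0 <= mu w,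
        \sum_w mu w = 1,
        forall w, (cost (P w) <= c)%N
      & forall x y, 2 / 3 <= \sum_(w | run (P w) x y == M x y) mu w].

Fixpoint ask_bob (X Y : eqType) (f : Y -> bool) (s : seq Y) : protocol X Y :=
  if s is y :: s' then Bob (pred1 y) (ask_bob X f s') (Output (f y))
  else Output false.

Fixpoint ask_alice (X Y : eqType) (f : X -> Y -> bool) (s : seq X) (t : seq Y) :
    protocol X Y :=
  if s is x :: s' then Alice (pred1 x) (ask_alice f s' t) (ask_bob X (f x) t)
  else Output false.

Lemma run_ask_bob (X Y : eqType) (f : Y -> bool) s x y :
  y \in s -> run (ask_bob X f s) x y = f y.
Proof.
elim: s => //= z s IHs; rewrite inE.
by case: eqVneq => [-> //|_] /=; exact: IHs.
Qed.

Lemma run_ask_alice (X Y : eqType) (f : X -> Y -> bool) s t x y :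
  x \in s -> y \in t -> run (ask_alice f s t) x y = f x y.
Proof.
elim: s => //= z s IHs; rewrite inE.
case: eqVneq => [-> _ yt|_ /= xs yt]; first exact: run_ask_bob.
exact: IHs.
Qed.

Lemma randomized_cc_subproof m n (M : 'M[bool]_(m, n)) :
  exists c, `[< randomized_protocol_of_cost M c >].
Proof.
pose p := ask_alice (fun x y => M x y) (enum 'I_m) (enum 'I_n).
exists (cost p); apply/asboolP.
exists unit, (fun=> 1), (fun=> p); split=> // [|x y].
  by rewrite big_const card_unit /= addr0.
rewrite (eq_bigl predT) => [|w]; last by rewrite run_ask_alice ?mem_enum ?eqxx.
by rewrite big_const card_unit /= addr0 ler_pdivrMr ?ltr0n // mul1r ler_nat.
Qed.

Definition randomized_cc m n (M : 'M[bool]_(m, n)) : nat :=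
  ex_minn (randomized_cc_subproof M).

Definition class_randomized_cc (C : graph_class) (N : nat) : nat :=
  \max_(G in C N) randomized_cc (adj G).

Definition biclass_randomized_cc (C : bigraph_class) (N : nat) : nat :=
  \max_(m < N.+1) \max_(G in C m (N - m)%N) randomized_cc G.

End RandomizedCC.

Definition bounded_by_constant (f : nat -> nat) : Prop :=
  exists c, forall N, (f N <= c)%N.

Definition has_chain (V : finType) (e : rel V) (k : nat) : bool :=
  [exists a : k.-tuple V, exists b : k.-tuple V,
    uniq (a ++ b) &&
    [forall i : 'I_k, forall j : 'I_k, (i < j)%N ==>
      e (tnth a i) (tnth b j) && ~~ e (tnth b i) (tnth a j)]].

(* A chain of length k uses 2k distinct vertices, so k <= #|V|. *)
Definition chain_index (V : finType) (e : rel V) : nat :=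
  \max_(k < #|V|.+1 | has_chain e k) k.

Definition stable (C : graph_class) : Prop :=
  exists k, forall n (G : sgraph n), G \in C n -> (chain_index (edge G) <= k)%N.

Definition bistable (C : bigraph_class) : Prop :=
  exists k, forall m n (G : bigraph m n),
    G \in C m n -> (chain_index (biedge G) <= k)%N.

Definition encodable (R : realType) (D : seq bool -> seq bool -> bool) (c : R)
    (V : finType) (e : rel V) : Prop :=
  exists enc : V -> seq bool,
    ((2 <= #|V|)%N -> forall v, (size (enc v))%:R <= c * ln (#|V|%:R : R)) /\
    (forall u v, D (enc u) (enc v) = e u v).

Definition has_implicit_representation (R : realType) (C : graph_class) : Prop :=
  exists (D : seq bool -> seq bool -> bool) (c : R),
    forall n (G : sgraph n), G \in C n -> encodable D c (edge G).

Definition bihas_implicit_representation (R : realType) (C : bigraph_class) : Prop :=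
  exists (D : seq bool -> seq bool -> bool) (c : R),
    forall m n (G : bigraph m n), G \in C m n -> encodable D c (biedge G).

Definition unit_disk_class (R : realType) (C : graph_class) : Prop :=
  forall n (G : sgraph n), G \in C n -> unit_disk R (edge G).

Definition biunit_disk_class (R : realType) (C : bigraph_class) : Prop :=
  forall m n (G : bigraph m n), G \in C m n -> unit_disk R (biedge G).

Definition class_sign_rank_le (R : realType) (C : graph_class) (r : nat) : Prop :=
  forall n (G : sgraph n), G \in C n -> (sign_rank R G <= r)%N.

Definition biclass_sign_rank_le (R : realType) (C : bigraph_class) (r : nat) : Prop :=
  forall m n (G : bigraph m n), G \in C m n -> (bisign_rank R G <= r)%N.

(* Main.v *)
Require Import Defs.
From mathcomp Require Import all_boot all_order all_fingroup all_algebra.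
From mathcomp Require Import boolp reals exp.
From mathcomp Require Import zify ring lra.

Set Implicit Arguments.
Unset Strict Implicit.
Unset Printing Implicit Defensive.

Import Order.TTheory GRing.Theory Num.Theory.

(* A stable matrix of one of these classes is computed by a decision tree of bounded
   depth whose queries are equalities f(x) = g(y); hashing the queried values gives a
   constant-cost randomized protocol, and writing them down gives the labels.

   After splitting rows and columns into boundedly many blocks (signs of coordinates
   for sign-rank 3, pairs of unit grid cells for unit disk graphs), rows and columns
   can be ordered so that no rows x1 < x2 and columns y1 < y2 carry the identity
   pattern. As in a point-line arrangement, such a matrix has hull rows; if moreover
   no column contains another, every hull row is an interval of columns, cutting the
   columns greedily along these intervals puts each level inside one hull row, and
   each row meets at most four levels. Hence equality tests on the level reduce M to
   its restrictions to the columns containing a given row. Stability bounds the length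
   of inclusion chains, hence the number of antichains of columns needed, and, by a
   Ramsey argument, the Littlestone rank. Each row splits the columns into two sides
   of which one has smaller rank, so (complementing M for the rows where this is the
   zero side) the reduction is iterated a bounded number of times.

   Conversely, a cost-c protocol writes M as the sign of an inner product of vectors of
   norm at most 2^(c/2) with margin 1/3, and the mistake bound of the perceptron limits
   the length of a binary search, hence of a half-graph in M. *)

(** * Equality decision trees *)

(** Trees are kept as a predicate on matrices: both subtrees compute matrices on all of [X] and [Y],
    so no domain is tracked along a branch. *)
Fixpoint eqc (X Y : Type) (d : nat) (M : X -> Y -> bool) : Prop :=
  if d is d'.+1 then
    exists (f : X -> nat) (g : Y -> nat) (M0 M1 : X -> Y -> bool),
      [/\ eqc d' M0, eqc d' M1 &
        forall x y, M x y = if f x == g y then M1 x y else M0 x y]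
  else exists b, forall x y, M x y = b.

Arguments eqc X Y d M : simpl never.

Section EqComplexity.
Variables X Y : Type.
Implicit Types (M N : X -> Y -> bool) (d e : nat).

Lemma eqc_ext d M N : (forall x y, M x y = N x y) -> eqc d M -> eqc d N.
Proof. by move=> MN; have -> : N = M by apply/funext => x; apply/funext => y. Qed.

Lemma eqc_const d b : eqc d (fun (_ : X) (_ : Y) => b).
Proof.
elim: d => [|d IHd]; first by exists b.
by exists (fun=> 0), (fun=> 0), (fun _ _ => b), (fun _ _ => b); split.
Qed.

Lemma eqc_leq d e M : d <= e -> eqc d M -> eqc e M.
Proof.
elim: e d M => [|e IHe] [|d] M //=; first by move=> _ [b Mb]; apply: eqc_ext (eqc_const e.+1 b).
rewrite ltnS => de [f [g [M0 [M1 [H0 H1 ME]]]]].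
by exists f, g, M0, M1; split=> //; apply: IHe de _.
Qed.

Lemma eqc_eq (f : X -> nat) (g : Y -> nat) : eqc 1 (fun x y => f x == g y).
Proof.
exists f, g, (fun _ _ => false), (fun _ _ => true).
by split=> [||x y]; [exists false | exists true | case: eqP].
Qed.

Lemma eqc_rows (p : X -> bool) : eqc 1 (fun (x : X) (_ : Y) => p x).
Proof. by apply: eqc_ext (eqc_eq p (fun=> 1)) => x y; case: (p x). Qed.

Lemma eqc_cols (q : Y -> bool) : eqc 1 (fun (_ : X) (y : Y) => q y).
Proof. by apply: eqc_ext (eqc_eq (fun=> 1) q) => x y; case: (q y). Qed.

(** Each leaf of the tree for [C] receives only one of the two other trees, so they can share the
    depth [d]. *)
Lemma eqc_if c d C M N : eqc c C -> eqc d M -> eqc d N ->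
  eqc (c + d) (fun x y => if C x y then M x y else N x y).
Proof.
move=> hC hM hN; elim: c C hC => [C [b Cb]|c IHc C [f [g [C0 [C1 [/IHc h0 /IHc h1 CE]]]]]].
  by case: b Cb => Cb; [apply: eqc_ext hM | apply: eqc_ext hN] => x y; rewrite Cb.
exists f, g, (fun x y => if C0 x y then M x y else N x y),
  (fun x y => if C1 x y then M x y else N x y).
by split; [exact: h0 | exact: h1 | move=> x y; rewrite CE; case: (f x == g y)].
Qed.

Lemma eqc_negb d M : eqc d M -> eqc d (fun x y => ~~ M x y).
Proof.
move=> hM; rewrite -[d]addn0.
apply: eqc_ext (eqc_if hM (eqc_const 0 false) (eqc_const 0 true)) => x y.
by case: (M x y).
Qed.

Lemma eqc_and d e M N : eqc d M -> eqc e N -> eqc (d + e) (fun x y => M x y && N x y).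
Proof.
move=> hM hN; apply: eqc_ext (eqc_if hM hN (eqc_const e false)) => x y.
by case: (M x y).
Qed.

Lemma eqc_or d e M N : eqc d M -> eqc e N -> eqc (d + e) (fun x y => M x y || N x y).
Proof.
move=> hM hN; apply: eqc_ext (eqc_if hM (eqc_const e true) hN) => x y.
by case: (M x y).
Qed.

Lemma eqc_has (T : Type) (s : seq T) d (F : T -> X -> Y -> bool) :
  (forall t, eqc d (F t)) -> eqc (size s * d) (fun x y => has (fun t => F t x y) s).
Proof.
move=> hF; elim: s => [|t s IHs] /=; first exact: eqc_const.
by rewrite mulSn; apply: eqc_or.
Qed.

(* The players share their block, so all blocks can be run in parallel along one
   tree, each query being tagged with the block it comes from. *)
Lemma eqc_family d (F : nat -> X -> Y -> bool) (bx : X -> nat) (by_ : Y -> nat) :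
  (forall i, eqc d (F i)) ->
  exists2 M, eqc d.+1 M & forall x y, bx x = by_ y -> M x y = F (bx x) x y.
Proof.
elim: d F => [|d IHd] F hF.
  have [b bE] := choice hF; exists (fun x _ => b (bx x)); first exact: eqc_rows.
  by move=> x y _; rewrite bE.
have [f hf] := choice hF; have [g hg] := choice hf.
have [F0 hF0] := choice hg; have [F1 hF1] := choice hF0.
have [|M0 hM0 M0E] := IHd F0; first by move=> i; case: (hF1 i).
have [|M1 hM1 M1E] := IHd F1; first by move=> i; case: (hF1 i).
exists (fun x y => if pickle (bx x, f (bx x) x) == pickle (by_ y, g (by_ y) y)
                   then M1 x y else M0 x y).
  by exists (fun x => pickle (bx x, f (bx x) x)), (fun y => pickle (by_ y, g (by_ y) y)), M0, M1.
move=> x y bxy; rewrite (inj_eq (pcan_inj pickleK)) -bxy xpair_eqE eqxx /=.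
by have [_ _ ->] := hF1 (bx x); rewrite M1E ?M0E.
Qed.

End EqComplexity.

Lemma eqc_partial (X Y X' Y' : Type) (p : X' -> option X) (q : Y' -> option Y)
    d (M : X -> Y -> bool) : eqc d M ->
  exists2 M', eqc d M' &
    forall x' y' x y, p x' = Some x -> q y' = Some y -> M' x' y' = M x y.
Proof.
elim: d M => [M [b Mb]|d IHd M [f [g [M0 [M1 [/IHd[N0 h0 N0E] /IHd[N1 h1 N1E] ME]]]]]].
  by exists (fun _ _ => b) => [|x' y' x y _ _]; [exists b | rewrite Mb].
pose f' x' := oapp f 0 (p x'); pose g' y' := oapp g 0 (q y').
exists (fun x' y' => if f' x' == g' y' then N1 x' y' else N0 x' y').
  by exists f', g', N0, N1.
move=> x' y' x y px qy; rewrite ME /f' /g' px qy /=.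
by rewrite (N0E _ _ _ _ px qy) (N1E _ _ _ _ px qy).
Qed.

Lemma eqc_comp (X Y X' Y' : Type) (p : X' -> X) (q : Y' -> Y) d (M : X -> Y -> bool) :
  eqc d M -> eqc d (fun x y => M (p x) (q y)).
Proof.
move=> /(eqc_partial (fun x => Some (p x)) (fun y => Some (q y)))[M' hM' M'E].
by apply: eqc_ext hM' => x y; apply: M'E.
Qed.

Lemma eqc_swap (X Y : Type) d (M : X -> Y -> bool) :
  eqc d M -> eqc d (fun y x => M x y).
Proof.
elim: d M => [M [b Mb]|d IHd M [f [g [M0 [M1 [/IHd h0 /IHd h1 ME]]]]]]; first by exists b.
by exists g, f, (fun y x => M0 x y), (fun y x => M1 x y); split=> // y x; rewrite ME eq_sym.
Qed.

Section EqcOn.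
Variables X Y : finType.
Implicit Types (M N : X -> Y -> bool) (A : {set X}) (B : {set Y}).

(** A tree on the full matrix, trusted only on [A] and [B]; this avoids subtypes. *)
Definition eqc_on d A B M : Prop :=
  exists2 N, eqc d N & {in A & B, forall x y, N x y = M x y}.

Lemma eqc_onS d A A' B B' M : A \subset A' -> B \subset B' ->
  eqc_on d A' B' M -> eqc_on d A B M.
Proof.
move=> /subsetP AA' /subsetP BB' [N hN NE]; exists N => // x y xA yB.
by apply: NE; [apply: AA' | apply: BB'].
Qed.

Lemma eqc_on_negb d A B M : eqc_on d A B (fun x y => ~~ M x y) -> eqc_on d A B M.
Proof.
move=> [N /eqc_negb hN NE]; exists (fun x y => ~~ N x y) => // x y xA yB.
by rewrite NE // negbK.
Qed.

Lemma eqc_on_set0 d A M : eqc_on d A set0 M.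
Proof. by exists (fun _ _ => true) => [|x y _]; [exact: eqc_const | rewrite inE]. Qed.

Lemma eqc_on_splitX d e A B M (p : pred X) :
  eqc_on d [set x in A | p x] B M -> eqc_on e [set x in A | ~~ p x] B M ->
  eqc_on (1 + (d + e)) A B M.
Proof.
move=> [N hN NE] [P hP PE]; exists (fun x y => if p x then N x y else P x y).
  apply: eqc_if (eqc_rows _ p) (eqc_leq _ hN) (eqc_leq _ hP).
    exact: leq_addr.
  exact: leq_addl.
by move=> x y xA yB; case: ifP => px; [apply: NE | apply: PE] => //; rewrite inE xA ?px.
Qed.

Lemma eqc_on_splitY d e A B M (q : pred Y) :
  eqc_on d A [set y in B | q y] M -> eqc_on e A [set y in B | ~~ q y] M ->
  eqc_on (1 + (d + e)) A B M.
Proof.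
move=> [N hN NE] [P hP PE]; exists (fun x y => if q y then N x y else P x y).
  apply: eqc_if (eqc_cols _ q) (eqc_leq _ hN) (eqc_leq _ hP).
    exact: leq_addr.
  exact: leq_addl.
by move=> x y xA yB; case: ifP => qy; [apply: NE | apply: PE] => //; rewrite inE yB ?qy.
Qed.

Lemma eqc_on_blocks d A B M (bx : X -> nat) (by_ : Y -> nat) :
  (forall i, eqc_on d [set x in A | bx x == i] [set y in B | by_ y == i] M) ->
  exists2 N, eqc d.+1 N & {in A & B, forall x y, bx x = by_ y -> N x y = M x y}.
Proof.
move=> h.
have {}h i : exists N, eqc d N /\ {in A & B, forall x y, bx x = i -> by_ y = i -> N x y = M x y}.
  have [N hN NE] := h i; exists N; split=> // x y xA yB xi yi.
  by apply: NE; rewrite inE ?xA ?yB ?xi ?yi eqxx.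
have [F hF] := choice h; have [|N hN NE] := @eqc_family _ _ d F bx by_.
  by move=> i; case: (hF i).
exists N => // x y xA yB bxy; rewrite NE //.
by have [_ ->] := hF (bx x).
Qed.

End EqcOn.

(** * Ordered matrices without the identity pattern *)

Section Star.
Variables (X Y : finType) (M : X -> Y -> bool).
Implicit Types (A : {set X}) (B : {set Y}) (a : X -> int) (m : Y -> int).

(** Identity patterns, up to permutation, lie along the increasing diagonal. Orders are integer
    ranks so that reversing one is negation. *)
Definition star a m A B : Prop :=
  forall x1 x2 y1 y2, x1 \in A -> x2 \in A -> y1 \in B -> y2 \in B ->
    M x1 y1 -> M x2 y2 -> ~~ M x1 y2 -> ~~ M x2 y1 ->
    (a x1 < a x2)%R -> (m y1 < m y2)%R.

Lemma starS a m A A' B B' : A \subset A' -> B \subset B' ->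
  star a m A' B' -> star a m A B.
Proof.
move=> /subsetP AA' /subsetP BB' st x1 x2 y1 y2 /AA' ? /AA' ? /BB' ? /BB' ?.
exact: st.
Qed.

Lemma star_opp a m A B : star a m A B ->
  star (fun x => - a x)%R (fun y => - m y)%R A B.
Proof.
move=> st x1 x2 y1 y2 x1A x2A y1B y2B M11 M22 M12 M21; rewrite !ltrN2.
exact: st.
Qed.

(* In the model of points above lines, h is on the upper hull: no line has it below
   and points above it on both sides. *)
Definition hull a A B h : Prop :=
  h \in A /\ forall y p q, y \in B -> p \in A -> q \in A ->
    (a p < a h)%R -> (a h < a q)%R -> M p y -> M q y -> M h y.

Lemma hull_opp a A B h : hull a A B h -> hull (fun x => - a x)%R A B h.
Proof.
move=> [hA hh]; split=> // y p q yB pA qA; rewrite !ltrN2 => hp qh Mp Mq.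
exact: (hh y q p).
Qed.

(** A column holding [x0] but neither [p0] nor [q0] would come after [y0], by the rows [p0] and
    [x0], and before it, by [x0] and [q0]. *)
Lemma skip_cover a m A B x0 p0 q0 y0 : star a m A B ->
  x0 \in A -> p0 \in A -> q0 \in A -> y0 \in B ->
  (a p0 < a x0)%R -> (a x0 < a q0)%R -> M p0 y0 -> M q0 y0 -> ~~ M x0 y0 ->
  forall y, y \in B -> M x0 y -> M p0 y || M q0 y.
Proof.
move=> st x0A p0A q0A y0B px xq Mp Mq Mx y yB Mxy; apply/norP => -[Mpy Mqy].
have l1 : (m y0 < m y)%R by apply: (st p0 x0).
have l2 : (m y < m y0)%R by apply: (st x0 q0).
by move: (lt_trans l1 l2); rewrite ltxx.
Qed.

(** As a left end, [x0] can be replaced by [p0], or by [q0] if that lies left of [h]. If [q0] lies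
    right of [h], then [h] is in [y0], and [star] gives the contradiction of [skip_cover] with [h]
    in place of [q0]. *)
Lemma hull_delete_left a m A B x0 p0 q0 y0 h : star a m A B -> injective a ->
  x0 \in A -> p0 \in A -> q0 \in A -> y0 \in B ->
  (a p0 < a x0)%R -> (a x0 < a q0)%R -> M p0 y0 -> M q0 y0 -> ~~ M x0 y0 ->
  hull a (A :\ x0) B h ->
  forall y q, y \in B -> q \in A ->
    (a x0 < a h)%R -> (a h < a q)%R -> M x0 y -> M q y -> M h y.
Proof.
move=> st ainj x0A p0A q0A y0B px xq Mp Mq Mx [hA hh] y q yB qA xh hq Mxy Mqy.
have neq u v : (a u < a v)%R -> u != v by apply: contraTneq => ->; rewrite ltxx.
have inA' u : u \in A -> u != x0 -> u \in A :\ x0 by move=> uA ux; rewrite !inE ux.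
have qA' : q \in A :\ x0 by apply: inA' => //; rewrite eq_sym neq // (lt_trans xh).
have pA' : p0 \in A :\ x0 by apply: inA' => //; apply: neq.
have q0A' : q0 \in A :\ x0 by apply: inA' => //; rewrite eq_sym neq.
have {hA} hA : h \in A by move: hA; rewrite inE => /andP[].
have := skip_cover st x0A p0A q0A y0B px xq Mp Mq Mx yB Mxy.
have [Mpy _|Mpy /= Mq0y] := boolP (M p0 y).
  by apply: (hh y p0 q) => //; apply: lt_trans xh.
have [qh|hq0|/ainj <- //] := ltgtP (a q0) (a h); first exact: (hh y q0 q).
have Mh0 : M h y0 by apply: (hh y0 p0 q0) => //; apply: lt_trans xh.
apply: contraT => Mh.
have l1 : (m y0 < m y)%R by apply: (st p0 x0).
have l2 : (m y < m y0)%R by apply: (st x0 h).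
by move: (lt_trans l1 l2); rewrite ltxx.
Qed.

(* Deleting a point that is not on the hull neither empties a column nor creates
   new hull points. *)
Lemma hull_meets a m A B y x : star a m A B -> injective a ->
  y \in B -> x \in A -> M x y -> exists2 h, hull a A B h & M h y.
Proof.
move=> st ainj yB; have [n] := ubnP #|A|.
elim: n A st x => // n IHn A st x ltn xA Mxy.
have [allh|] := pselect (forall z, z \in A -> hull a A B z).
  by exists x => //; apply: allh.
move=> /existsNP[x0 /not_implyP[x0A nh]].
have [y0 [p0 [q0 [y0B p0A q0A [px xq Mp Mq Mx]]]]] : exists y0 p0 q0,
    [/\ y0 \in B, p0 \in A, q0 \in A &
     [/\ (a p0 < a x0)%R, (a x0 < a q0)%R, M p0 y0, M q0 y0 & ~~ M x0 y0]].
  apply: contra_notP nh => nh; split=> // y0 p q y0B pA qA px xq Mp Mq.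
  by apply: contraT => Mx; case: nh; exists y0, p, q.
have neq u v : (a u < a v)%R -> u != v by apply: contraTneq => ->; rewrite ltxx.
have [x' x'A Mx'y] : exists2 x', x' \in A :\ x0 & M x' y.
  have [xx0|xx0] := eqVneq x x0; last by exists x; rewrite // !inE xx0.
  rewrite xx0 in Mxy.
  have /orP[Mpy|Mqy] := skip_cover st x0A p0A q0A y0B px xq Mp Mq Mx yB Mxy.
    by exists p0; rewrite // !inE neq.
  by exists q0; rewrite // !inE eq_sym neq.
have stA : star a m (A :\ x0) B by apply: starS st => //; apply: subsetDl.
have ltA : #|A :\ x0| < n by rewrite (cardsD1 x0) x0A in ltn.
have [h hh Mhy] := IHn _ stA x' ltA x'A Mx'y.
exists h => //; have hA : h \in A by case: hh; rewrite inE => /andP[].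
split=> // y1 p q y1B pA qA ph hq Mpy Mqy.
have [px0|px0] := eqVneq p x0.
  rewrite px0 in pA ph Mpy.
  exact: (hull_delete_left st ainj x0A p0A q0A y0B px xq Mp Mq Mx hh y1B qA).
have [qx0|qx0] := eqVneq q x0.
  rewrite qx0 in qA hq Mqy.
  have ainj' : injective (fun x => - a x)%R by move=> u v /oppr_inj/ainj.
  apply: (hull_delete_left (star_opp st) ainj' x0A q0A p0A y0B _ _ _ _ _
    (hull_opp hh) y1B pA _ _ _ _) => //; by rewrite ltrN2.
by case: hh => _ hh; apply: (hh y1 p q) => //; rewrite !inE ?px0 ?qx0.
Qed.

Definition two_levels (lev : Y -> nat) (P : Y -> Prop) : Prop :=
  exists l, forall y, P y -> lev y = l \/ lev y = l.+1.

(** Among the hull rows up to [x] that share a column with [x], the last one contains every column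
    shared by [x] and an earlier one, since it lies between them. Its two levels suffice. *)
Lemma two_levels_left a A B (lev : Y -> nat) x : injective a -> x \in A ->
  (forall h, hull a A B h -> two_levels lev (fun y => y \in B /\ M h y)) ->
  two_levels lev (fun y => [/\ y \in B, M x y &
    exists h, [/\ hull a A B h, (a h <= a x)%R & M h y]]).
Proof.
move=> ainj xA Hlev.
pose C := [set h | `[< [/\ hull a A B h, (a h <= a x)%R &
                           exists y, [/\ y \in B, M x y & M h y]] >]].
have CP h : reflect [/\ hull a A B h, (a h <= a x)%R &
    exists y, [/\ y \in B, M x y & M h y]] (h \in C).
  by rewrite inE; apply: asboolP.
have [C0|[h0 h0C]] := set_0Vmem C.
  exists 0 => y [yB Mxy [h [hh hx Mhy]]].
  suff : h \in C by rewrite C0 inE.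
  by apply/CP; split=> //; exists y.
case: (@Order.TotalTheory.arg_maxP _ _ _ h0 (mem C) a h0C) => hs hsC hsmax.
have /CP[hhs hsx _] := hsC.
have [l ll] := Hlev hs hhs; exists l => y [yB Mxy [h [hh hx Mhy]]].
apply: ll; split=> //.
have : (a h <= a hs)%R by apply: hsmax; apply/CP; split=> //; exists y.
rewrite le_eqVlt => /orP[/eqP/ainj <- //|hhs'].
move: hsx; rewrite le_eqVlt => /orP[/eqP/ainj -> //|hsx].
by case: hhs => _ Hs; apply: (Hs y h x) => //; case: hh.
Qed.

Lemma two_levels_row a m A B (lev : Y -> nat) x : star a m A B -> injective a ->
  x \in A ->
  (forall h, hull a A B h -> two_levels lev (fun y => y \in B /\ M h y)) ->
  exists l1 l2, forall y, y \in B -> M x y ->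
    lev y \in [:: l1; l1.+1; l2; l2.+1].
Proof.
move=> st ainj xA Hlev.
have ainj' : injective (fun x => - a x)%R by move=> u v /oppr_inj/ainj.
have [l1 L1] := two_levels_left ainj xA Hlev.
have [|l2 L2] := @two_levels_left _ A B lev x ainj' xA.
  move=> h /hull_opp hh; apply: Hlev.
  have aK : (fun x => - - a x)%R = a by apply/funext => z; rewrite opprK.
  by rewrite -aK.
exists l1, l2 => y yB Mxy; have [h hh Mhy] := hull_meets st ainj yB xA Mxy.
rewrite !inE; have [hx|/ltW hx] := leP (a h) (a x).
  by case: (L1 y) => [|->|->]; rewrite ?eqxx ?orbT //; split=> //; exists h.
case: (L2 y) => [|->|->]; rewrite ?eqxx ?orbT //; split=> //; exists h.
by split; rewrite ?lerN2 //; apply: hull_opp.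
Qed.

(** No trace on [A] is strictly contained in another; columns with equal traces may coexist. *)
Definition antichain A B : Prop :=
  forall y z, y \in B -> z \in B -> (exists2 x, x \in A & M x y && ~~ M x z) ->
    exists2 x, x \in A & M x z && ~~ M x y.

(** If [h] missed [y2], there would be rows [p] and [q] of [y2] outside [y1] and [y3] respectively;
    [star] puts [q] left and [p] right of [h], against the hull condition. *)
Lemma hull_convex a m A B h y1 y2 y3 : star a m A B -> injective a ->
  injective m -> antichain A B -> hull a A B h ->
  y1 \in B -> y2 \in B -> y3 \in B ->
  (m y1 <= m y2)%R -> (m y2 <= m y3)%R -> M h y1 -> M h y3 -> M h y2.
Proof.
move=> st ainj minj ac [hA hh] y1B y2B y3B.
rewrite le_eqVlt => /orP[/eqP/minj -> //|y12].
rewrite le_eqVlt => /orP[/eqP/minj -> //|y23] M1 M3; apply: contraT => M2.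
have neq u y : M h y -> ~~ M u y -> a u != a h.
  by move=> Mhy; apply: contraNneq => /ainj->.
have [|p pA /andP[p2 p1]] := ac y1 y2 y1B y2B.
  by exists h; rewrite ?M1.
have [|q qA /andP[q2 q3]] := ac y3 y2 y3B y2B.
  by exists h; rewrite ?M3.
have hp : (a h < a p)%R.
  case: ltgtP (neq p y1 M1 p1) => // ph _.
  have : (m y2 < m y1)%R by apply: (st p h).
  by rewrite ltNge (ltW y12).
have qh : (a q < a h)%R.
  case: ltgtP (neq q y3 M3 q3) => // ph _.
  have : (m y3 < m y2)%R by apply: (st h q).
  by rewrite ltNge (ltW y23).
by rewrite (hh y2 q p) in M2.
Qed.

End Star.

(* Greedy cut of an ordered set covered by intervals: each level is the part of
   what remains that is reached by the intervals containing its least element. *)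
Lemma interval_levels (T : finType) (J : Type) (m : T -> int) (B : {set T})
    (I : J -> T -> bool) : injective m ->
  (forall j y1 y2 y3, y1 \in B -> y2 \in B -> y3 \in B ->
     (m y1 <= m y2)%R -> (m y2 <= m y3)%R -> I j y1 -> I j y3 -> I j y2) ->
  (forall y, y \in B -> exists j, I j y) ->
  exists lev : T -> nat,
    [/\ forall y, y \in B -> exists j, forall z, z \in B -> lev z = lev y -> I j z,
        forall j, two_levels lev (fun y => y \in B /\ I j y) &
        forall t z j, t \in B -> (forall y, y \in B -> (m t <= m y)%R) ->
          z \in B -> I j t -> I j z -> lev z = 0].
Proof.
move=> minj; have [n] := ubnP #|B|; elim: n B => // n IHn B ltn cvx cov.
have [->|[t0 t0B]] := set_0Vmem B.
  by exists (fun=> 0); split=> [y|j|t z j]; rewrite ?inE //; exists 0 => y [_ _]; left.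
case: (@Order.TotalTheory.arg_minP _ _ _ t0 (mem B) m t0B) => t tB0 tmin.
have tB : t \in B := tB0.
pose S := [set z in B | `[< exists j, I j t && I j z >]].
have tS : t \in S.
  by rewrite inE tB; apply/asboolP; have [j tj] := cov t tB; exists j; rewrite tj.
case: (@Order.TotalTheory.arg_maxP _ _ _ t (mem S) m tS) => s sS smax.
have : s \in S := sS; rewrite inE => /andP[sB /asboolP[j0 /andP[j0t j0s]]].
pose B' := [set z in B | (m s < m z)%R].
have B'B : {subset B' <= B} by move=> z; rewrite inE => /andP[].
have ltB' : #|B'| < n.
  rewrite -ltnS; apply: leq_trans ltn; rewrite ltnS; apply: proper_card.
  apply/properP; split; first exact/subsetP.
  by exists s => //; rewrite inE ltxx andbF.
have [||lev [levI lev2 lev0]] := IHn B' ltB'.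
- by move=> j y1 y2 y3 /B'B ? /B'B ? /B'B ?; apply: cvx.
- by move=> y /B'B; apply: cov.
pose lev' z := if (m z <= m s)%R then 0 else (lev z).+1.
have S0 j z : z \in B -> I j t -> I j z -> (m z <= m s)%R.
  move=> zB jt jz; apply: smax; suff : z \in S by [].
  by rewrite inE zB; apply/asboolP; exists j; rewrite jt.
exists lev'; split.
- move=> y yB; rewrite /lev'; case: leP => ys.
    exists j0 => z zB; case: ifP => // zs _.
    by apply: (cvx j0 t z s) => //; apply: tmin.
  have yB' : y \in B' by rewrite inE yB.
  have [j Hj] := levI y yB'; exists j => z zB; case: leP => // zs [].
  by apply: Hj; rewrite inE zB.
(* An interval that meets the first level and goes beyond [s] contains the least remaining element,
   by convexity; the third invariant then puts the rest of it in the next level. *)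
- move=> j; have [[y [yB ys jy]]|nex] :=
      pselect (exists y, [/\ y \in B, (m y <= m s)%R & I j y]).
    exists 0 => z [zB jz]; rewrite /lev'; case: leP => zs; [by left | right].
    have zB' : z \in B' by rewrite inE zB.
    case: (@Order.TotalTheory.arg_minP _ _ _ z (mem B') m zB') => t' t'B' t'min.
    congr _.+1; apply: (lev0 t' z j) => //.
    have /[!inE]/andP[t'B st'] : t' \in B' := t'B'.
    by apply: (cvx j y t' z) => //; [apply: le_trans ys (ltW st') | apply: t'min].
  have [l Hl] := lev2 j; exists l.+1 => z [zB jz]; rewrite /lev'.
  case: leP => zs; first by case: nex; exists z.
  by case: (Hl z) => [|->|->]; [rewrite inE zB | left | right].
- move=> t' z j t'B t'min zB jt' jz; rewrite /lev'.
  have -> // : (m z <= m s)%R.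
  have tt' : t' = t by apply: minj; apply/le_anti; rewrite t'min //= tmin.
  by apply: (S0 j) => //; rewrite -tt'.
Qed.

(** * Reduction along antichains and induction on the rank *)

Section Chains.
Variables (X Y : finType) (M : X -> Y -> bool).
Implicit Types (A : {set X}) (B : {set Y}).

(* Listed as pairs (x_i, y_i), a chain leaves the entries M x_i y_i unconstrained. *)
Definition chain_rel (M' : X -> Y -> bool) : rel (X * Y) :=
  fun u v => M' u.1 v.2 && ~~ M' v.1 u.2.

Definition chain (M' : X -> Y -> bool) k : Prop :=
  exists2 s : seq (X * Y), size s = k & pairwise (chain_rel M') s.

Definition below A z y : Prop :=
  (forall x, x \in A -> M x z -> M x y) /\
  exists2 x, x \in A & M x y && ~~ M x z.

Fixpoint height_ge A B n y : Prop :=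
  if n is n'.+1 then exists z, [/\ z \in B, below A z y & height_ge A B n' z]
  else True.

(** Each column of a strictly descending sequence is paired with a row that it lacks and the next
    larger column has; the smallest column comes first. *)
Lemma height_chain A B n y : height_ge A B n y ->
  exists s : seq (X * Y), [/\ size s = n, pairwise (chain_rel M) s &
    forall u, u \in s -> [/\ u.1 \in A, M u.1 y &
                          forall x, x \in A -> M x u.2 -> M x y]].
Proof.
elim: n y => [|n IHn] y /=; first by move=> _; exists [::].
move=> [z [zB [zy [x xA /andP[Mxy Mxz]]] /IHn[s [sn ps us]]]].
exists (rcons s (x, z)); split; first by rewrite size_rcons sn.
  rewrite pairwise_rcons ps andbT; apply/allP => u /us[uA Muz uz].
  by rewrite /chain_rel /= Muz; apply: contra Mxz; apply: uz.
move=> u; rewrite mem_rcons inE => /orP[/eqP-> //|/us[uA Muz uz]].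
by split=> // [|x' x'A Mx']; apply: zy => //; apply: uz.
Qed.

End Chains.

Lemma pairwise_rev (T : Type) (r : rel T) s :
  pairwise r (rev s) = pairwise (fun x y => r y x) s.
Proof.
by elim: s => //= x s IHs; rewrite rev_cons pairwise_rcons IHs all_rev.
Qed.

Lemma chain_negb (X Y : finType) (M : X -> Y -> bool) k :
  chain (fun x y => ~~ M x y) k -> chain M k.
Proof.
move=> [s sk ps]; exists (rev s); rewrite ?size_rev // pairwise_rev.
by apply: sub_pairwise ps => u v; rewrite /chain_rel negbK andbC.
Qed.

Section Step.
Variables (X Y : finType) (M : X -> Y -> bool) (A : {set X}).
Variables (a : X -> int) (m : Y -> int) (d : nat).
Hypotheses (ainj : injective a) (minj : injective m).
Implicit Types B : {set Y}.

(** One query splits off the empty columns, which cost 0; each of four candidate levels takes an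
    equality test and a blockwise tree of depth [d.+1]. *)
Definition antichain_cost := 1 + (4 * (1 + d.+1) + 0).

Lemma eqc_on_antichain B : star M a m A B -> antichain M A B ->
  (forall x, x \in A -> eqc_on d A [set y in B | M x y] M) ->
  eqc_on antichain_cost A B M.
Proof.
move=> st ac rows; apply: (@eqc_on_splitY _ _ _ _ _ _ _ (fun y => [exists x in A, M x y])); last first.
  exists (fun _ _ => false); first exact: eqc_const.
  move=> x y xA; rewrite inE => /andP[_ /exists_inP nex].
  by apply/esym/negbTE/negP => Mxy; apply: nex; exists x.
set B1 := [set y in B | _].
have B1B : B1 \subset B by apply/subsetP => y; rewrite inE => /andP[].
have B1B' := subsetP B1B.
have st1 : star M a m A B1 by apply: starS st.
have ac1 : antichain M A B1 by move=> y z /B1B' yB /B1B' zB; apply: ac.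
(* The intervals are the hull rows; they cover because the empty columns are gone. *)
pose I (j : {h : X | hull M a A B1 h}) y := M (sval j) y.
have [||lev [levI lev2 _]] := @interval_levels Y _ m B1 I minj.
- move=> [h hh] y1 y2 y3 y1B y2B y3B y12 y23.
  exact: (hull_convex st1 ainj minj ac1 hh y1B y2B y3B).
- move=> y yB1; move: (yB1); rewrite inE => /andP[_ /exists_inP[x xA Mxy]].
  by have [h hh Mhy] := hull_meets st1 ainj yB1 xA Mxy; exists (exist _ h hh).
have /choice[lam lamP] : forall x, exists p : nat * nat, x \in A ->
    forall y, y \in B1 -> M x y -> lev y \in [:: p.1; p.1.+1; p.2; p.2.+1].
  move=> x; have [xA|] := boolP (x \in A); last by exists (0, 0).
  have [|l1 [l2 ll]] := @two_levels_row _ _ M a m A B1 lev x st1 ainj xA.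
    by move=> h hh; apply: (lev2 (exist _ h hh)).
  by exists (l1, l2).
(* However [f] assigns levels to rows, the columns of one level lie in a single hull row, for which
   the hypothesis provides a tree. *)
have blocks (f : X -> nat) i :
    eqc_on d [set x in A | f x == i] [set y in B1 | lev y == i] M.
  have [B0|[y0]] := set_0Vmem [set y in B1 | lev y == i].
    by rewrite B0; apply: eqc_on_set0.
  rewrite inE => /andP[y0B /eqP y0i]; have [[h hh] Hh] := levI y0 y0B.
  have hA := hh.1.
  apply: eqc_onS (rows h hA); first by apply/subsetP => x; rewrite inE => /andP[].
  apply/subsetP => y; rewrite !inE => /andP[yB /eqP yi].
  have yB1 : y \in B1 by rewrite inE yB.
  by case/andP: (yB) => -> _; apply: (Hh y yB1); rewrite y0i.
have /choice[N NP] : forall f : X -> nat, exists N, eqc d.+1 N /\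
    {in A & B1, forall x y, f x = lev y -> N x y = M x y}.
  by move=> f; have [N hN NE] := eqc_on_blocks (blocks f); exists N.
pose fs := [:: fun x => (lam x).1; fun x => (lam x).1.+1;
               fun x => (lam x).2; fun x => (lam x).2.+1].
exists (fun x y => has (fun f => (f x == lev y) && N f x y) fs).
  apply: (@eqc_has _ _ _ fs (1 + d.+1)) => f.
  by apply: eqc_and; [apply: eqc_eq | case: (NP f)].
move=> x y xA yB; apply/idP/idP => [/hasP[f _ /andP[/eqP fxy]]|Mxy].
  by have [_ ->] := NP f.
have K (f : X -> nat) : lev y = f x -> (f x == lev y) && N f x y.
  by move=> e; rewrite -e eqxx; have [_ ->] := NP f.
have := lamP x xA y yB Mxy; rewrite !inE /= => /or4P[] /eqP e.
- by rewrite (K (fun x => (lam x).1) e).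
- by rewrite (K (fun x => (lam x).1.+1) e) orbT.
- by rewrite (K (fun x => (lam x).2) e) !orbT.
- by rewrite (K (fun x => (lam x).2.+1) e) !orbT.
Qed.

(* Induction on n: the columns of height exactly n form an antichain. *)
Lemma eqc_on_heights B n : star M a m A B ->
  (forall x, x \in A -> eqc_on d A [set y in B | M x y] M) ->
  eqc_on (n * (1 + antichain_cost)) A
    [set y in B | ~~ `[< height_ge M A B n y >]] M.
Proof.
move=> st rows; elim: n => [|n IHn].
  have -> : [set y in B | ~~ `[< height_ge M A B 0 y >]] = set0.
    by apply/setP => y; rewrite !inE asboolT ?andbF.
  exact: eqc_on_set0.
rewrite mulSn -addnA; apply: (@eqc_on_splitY _ _ _ _ _ _ _
  (fun y => `[< height_ge M A B n y >])); last first.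
  apply: eqc_onS IHn => //; apply/subsetP => y.
  by rewrite !inE -andbA => /and3P[-> _ ->].
set Bn := [set _ in _ | _].
have BnP y : y \in Bn -> [/\ y \in B, ~ height_ge M A B n.+1 y & height_ge M A B n y].
  by rewrite !inE -andbA => /and3P[yB /asboolP ? /asboolP ?].
have BnB : Bn \subset B by apply/subsetP => y /BnP[].
apply: eqc_on_antichain; first exact: starS st.
  move=> y z /BnP[yB ny hy] /BnP[zB nz hz] yz; apply: contrapT => nex.
  apply: ny; exists z; split=> //; split=> // x xA Mxz; apply: contraT => Mxy.
  by case: nex; exists x; rewrite ?Mxz.
move=> x xA; apply: eqc_onS (rows x xA) => //; apply/subsetP => y.
by rewrite !inE => /andP[/andP[/andP[-> _] _] ->].
Qed.

Lemma eqc_on_chain_free B k : star M a m A B -> ~ chain M k ->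
  (forall x, x \in A -> eqc_on d A [set y in B | M x y] M) ->
  eqc_on (k * (1 + antichain_cost)) A B M.
Proof.
move=> st nch rows; apply: eqc_onS (eqc_on_heights k st rows) => //.
apply/subsetP => y yB; rewrite inE yB; apply/asboolP => /height_chain[s [sk ps _]].
by apply: nch; exists s.
Qed.

End Step.

(** Complementing exchanges the two diagonals of the pattern; reversing the row order exchanges them
    back. *)
Lemma star_negb (X Y : finType) (M : X -> Y -> bool) a m A B : star M a m A B ->
  star (fun x y => ~~ M x y) (fun x => - a x)%R m A B.
Proof.
move=> st x1 x2 y1 y2 x1A x2A y1B y2B N11 N22; rewrite !negbK ltrN2 => M12 M21.
exact: (st x2 x1).
Qed.

(** * Littlestone rank and chains *)

Section Rank.
Variables (X Y : finType) (M : X -> Y -> bool).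
Implicit Types (A : {set X}) (B : {set Y}).

(* Littlestone (Shelah) rank of the columns in B with respect to the rows in A. *)
Fixpoint rank_ge n A B : Prop :=
  if n is n'.+1 then exists x, [/\ x \in A,
    rank_ge n' A [set y in B | M x y] & rank_ge n' A [set y in B | ~~ M x y]]
  else B != set0.

Lemma rank_geS n A A' B B' : A \subset A' -> B \subset B' ->
  rank_ge n A B -> rank_ge n A' B'.
Proof.
move=> AA'; elim: n B B' => [|n IHn] B B' BB' /=.
  by apply: contraNneq => B0; rewrite -subset0 -B0.
move=> [x [xA h1 h0]]; exists x; split; first exact: (subsetP AA').
  by apply: IHn h1; apply/subsetP => y; rewrite !inE => /andP[/(subsetP BB')-> ->].
by apply: IHn h0; apply/subsetP => y; rewrite !inE => /andP[/(subsetP BB')-> ->].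
Qed.

Lemma rank_ge_neq0 n A B : rank_ge n A B -> B != set0.
Proof.
elim: n B => //= n IHn B [x [_ /IHn/set0Pn[y yB] _]].
by apply/set0Pn; exists y; move: yB; rewrite inE => /andP[].
Qed.

(** Ramsey property of binary trees with two-coloured nodes: the root joins the subtrees of its own
    colour found in both halves, unless one half already has a deep enough subtree of the other
    colour. *)
Lemma rank_ge_color (p : pred X) i j A B : rank_ge (i + j).+1 A B ->
  rank_ge i [set x in A | p x] B \/ rank_ge j [set x in A | ~~ p x] B.
Proof.
have [n] := ubnP (i + j); elim: n i j A B => // n IHn [|i] [|j] A B ltn h.
- by left; apply: rank_ge_neq0 h.
- by left; apply: rank_ge_neq0 h.
- by right; apply: rank_ge_neq0 h.
have sB (q : pred Y) : [set y in B | q y] \subset B.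
  by apply/subsetP => y; rewrite inE => /andP[].
case: h => x [xA h1 h0]; have [px|px] := boolP (p x).
  have lt' : i + j.+1 < n by lia.
  have [k1|k1] := IHn i j.+1 A _ lt' h1; last by right; apply: rank_geS k1.
  have [k0|k0] := IHn i j.+1 A _ lt' h0; last by right; apply: rank_geS k0.
  by left; exists x; split; rewrite // inE xA.
have lt' : i.+1 + j < n by lia.
have eqij : (i.+1 + j).+1 = i.+1 + j.+1 by rewrite addnS.
have [|k1|k1] := IHn i.+1 j A [set y in B | M x y] lt'; first by rewrite eqij.
  by left; apply: rank_geS k1.
have [|k0|k0] := IHn i.+1 j A [set y in B | ~~ M x y] lt'; first by rewrite eqij.
  by left; apply: rank_geS k0.
by right; exists x; split; rewrite // inE xA.
Qed.

Definition chain_in A B k : Prop :=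
  exists s : seq (X * Y), [/\ size s = k, pairwise (chain_rel M) s &
    {in s, forall u, u.1 \in A /\ u.2 \in B}].

Definition rev_chain_in A B k : Prop :=
  exists s : seq (X * Y), [/\ size s = k, pairwise (fun u v => chain_rel M v u) s &
    {in s, forall u, u.1 \in A /\ u.2 \in B}].

End Rank.

(** Fix a column [y] and colour the rows by their entry in it. In a colour class that keeps large
    rank, the root row [x] passes to the columns where its entry is opposite to that colour, and
    [(x, y)] goes in front of the chain found there. *)
Lemma chain_of_rank i j : exists n, forall (X Y : finType) (M : X -> Y -> bool) A B,
  rank_ge M n A B -> rev_chain_in M A B i \/ chain_in M A B j.
Proof.
elim: i j => [|i IHi] j; first by exists 0 => X Y M A B _; left; exists [::].
elim: j => [|j [n0 H0]]; first by exists 0 => X Y M A B _; right; exists [::].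
have [n1 H1] := IHi j.+1; exists (n1.+1 + n0.+1).+1 => X Y M A B h.
have sub (T : finType) (C : {set T}) (q : pred T) : {subset [set y in C | q y] <= C}.
  by move=> y; rewrite inE => /andP[].
have /set0Pn[y yB] := rank_ge_neq0 h.
have [[x [xA' _ h1]]|[x [xA' h1 _]]] := rank_ge_color (fun x => M x y) h.
  have [[s [si ps sAB]]|[s [sj ps sAB]]] := H1 _ _ _ _ _ h1; last first.
    right; exists s; split=> // u /sAB[u1 u2].
    by split; [apply: sub u1 | apply: sub u2].
  left; exists ((x, y) :: s); split; first by rewrite /= si.
    rewrite /= ps andbT; apply/allP => u /sAB[]; rewrite !inE /chain_rel /=.
    by move=> /andP[_ ->] /andP[_ ->].
  move=> u; rewrite inE => /orP[/eqP->|/sAB[u1 u2]]; first by split=> //; apply: sub xA'.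
  by split; [apply: sub u1 | apply: sub u2].
have [[s [si ps sAB]]|[s [sj ps sAB]]] := H0 _ _ _ _ _ h1.
  left; exists s; split=> // u /sAB[u1 u2].
  by split; [apply: sub u1 | apply: sub u2].
right; exists ((x, y) :: s); split; first by rewrite /= sj.
  rewrite /= ps andbT; apply/allP => u /sAB[]; rewrite !inE /chain_rel /=.
  by move=> /andP[_ ->] /andP[_ ->].
move=> u; rewrite inE => /orP[/eqP->|/sAB[u1 u2]]; first by split=> //; apply: sub xA'.
by split; [apply: sub u1 | apply: sub u2].
Qed.

Lemma chain_free_rank k : exists n, forall (X Y : finType) (M : X -> Y -> bool) A B,
  ~ chain M k -> ~ rank_ge M n A B.
Proof.
have [n Hn] := chain_of_rank k k; exists n => X Y M A B nch /Hn[][s [sk ps _]].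
  by apply: nch; exists (rev s); rewrite ?size_rev // pairwise_rev.
by apply: nch; exists s.
Qed.

(* Rows are split according to which side of them has smaller rank; for those
   where it is the zero side, the step is applied to the complement. *)
Lemma eqc_on_rank k r : exists d, forall (X Y : finType) (M : X -> Y -> bool) a m A B,
  injective a -> injective m -> ~ chain M k -> star M a m A B ->
  ~ rank_ge M r A B -> eqc_on d A B M.
Proof.
elim: r => [|r [d Hd]].
  exists 0 => X Y M a m A B _ _ _ _ /negP/negPn/eqP->; exact: eqc_on_set0.
exists (1 + (k * (1 + antichain_cost d) + k * (1 + antichain_cost d))).
move=> X Y M a m A B ainj minj nch st nrk.
pose low x := ~~ `[< rank_ge M r A [set y in B | M x y] >].
have sub (T : finType) (C : {set T}) (q : pred T) : [set y in C | q y] \subset C.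
  by apply/subsetP => y; rewrite inE => /andP[].
apply: (@eqc_on_splitX _ _ _ _ _ _ _ low).
  apply: (eqc_on_chain_free ainj minj) => //; first by apply: starS st.
  move=> x; rewrite inE => /andP[xA /asboolP lowx].
  apply: (Hd _ _ _ a m) => //; first by apply: starS st.
  by apply: contra_not lowx; apply: rank_geS.
have ainj' : injective (fun x => - a x)%R by move=> u v /oppr_inj/ainj.
apply: eqc_on_negb; apply: (eqc_on_chain_free ainj' minj) => [|/chain_negb//|].
  by apply: starS (star_negb st).
move=> x; rewrite inE => /andP[xA]; rewrite negbK => /asboolP highx.
have lowx : ~ rank_ge M r A [set y in B | ~~ M x y] by move=> lx; apply: nrk; exists x.
have [||N hN NE] := Hd _ _ M a m [set x in A | ~~ low x] [set y in B | ~~ M x y] ainj minj nch.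
- by apply: starS st.
- by apply: contra_not lowx; apply: rank_geS.
exists (fun x y => ~~ N x y); first exact: eqc_negb.
by move=> u v uA vB; rewrite NE.
Qed.

Lemma eqc_on_star k : exists d, forall (X Y : finType) (M : X -> Y -> bool) a m A B,
  injective a -> injective m -> ~ chain M k -> star M a m A B -> eqc_on d A B M.
Proof.
have [r Hr] := chain_free_rank k; have [d Hd] := eqc_on_rank k r.
exists d => X Y M a m A B ainj minj nch st.
by apply: (Hd _ _ _ a m) => //; apply: Hr.
Qed.

(** * Points, lines and disks *)

Section Geometry.
Variable R : realType.
Local Open Scope ring_scope.

(** Equal keys are ranked in some arbitrary order, which makes the ranking injective. *)
Lemma injective_rank (X : finType) (f : X -> R) :
  exists a : X -> int, injective a /\ forall x y, f x < f y -> a x < a y.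
Proof.
pose s := sort (fun x y => f x <= f y) (enum X).
have sX x : x \in s by rewrite mem_sort mem_enum.
exists (fun x => (index x s)%:Z); split.
  by move=> x y [/index_inj]; apply.
move=> x y fxy; rewrite ltz_nat ltnNge; apply: contraTN fxy => yx; rewrite -leNgt.
apply: (@sorted_leq_index _ (fun x y => f x <= f y) _ _ s _ y x) => //.
  by move=> u v w /le_trans; apply.
by rewrite /s; apply: sort_sorted => u v; apply: le_total.
Qed.

(** The pattern is excluded for weak inequalities because the ranks may order equal keys either
    way. *)
Lemma eqc_on_ordered k : exists d, forall (X Y : finType) (M : X -> Y -> bool)
    (f : X -> R) (g : Y -> R) (A : {set X}) (B : {set Y}),
  ~ chain M k ->
  (forall x1 x2 y1 y2, x1 \in A -> x2 \in A -> y1 \in B -> y2 \in B ->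
     M x1 y1 -> M x2 y2 -> ~~ M x1 y2 -> ~~ M x2 y1 ->
     f x1 <= f x2 -> g y2 <= g y1 -> False) ->
  eqc_on d A B M.
Proof.
have [d Hd] := eqc_on_star k; exists d => X Y M f g A B nch pat.
have [a [ainj fa]] := injective_rank f; have [m [minj gm]] := injective_rank g.
apply: (Hd _ _ _ a m) => // x1 x2 y1 y2 x1A x2A y1B y2B M11 M22 M12 M21 ax.
rewrite ltNge; apply/negP => my; apply: (pat x1 x2 y1 y2) => //.
  by rewrite leNgt; apply/negP => /fa; rewrite ltNge (ltW ax).
by rewrite leNgt; apply/negP => /gm; rewrite ltNge my.
Qed.

Definition split3_cost d := (1 + (d + (1 + (d + d))))%N.

Lemma sg_cases (z : R) : Num.sg z = 1 \/ Num.sg z = -1 \/ Num.sg z = 0.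
Proof. by case: sgrP; [right; right | left | right; left]. Qed.

Lemma eqc_on_sgX (X Y : finType) (M : X -> Y -> bool) (A : {set X})
    (B : {set Y}) d (w : X -> R) :
  (forall e, eqc_on d [set x in A | Num.sg (w x) == e] B M) ->
  eqc_on (split3_cost d) A B M.
Proof.
move=> h; apply: (@eqc_on_splitX _ _ _ _ _ _ _ (fun x => Num.sg (w x) == 1)) => //.
apply: (@eqc_on_splitX _ _ _ _ _ _ _ (fun x => Num.sg (w x) == -1)).
  by apply: eqc_onS (h (-1)) => //; apply/subsetP => x; rewrite !inE => /andP[/andP[-> _] ->].
apply: eqc_onS (h 0) => //; apply/subsetP => x; rewrite !inE => /andP[/andP[->]].
by case: (sg_cases (w x)) => [->|[->|->]]; rewrite eqxx.
Qed.

Lemma eqc_on_sgY (X Y : finType) (M : X -> Y -> bool) (A : {set X})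
    (B : {set Y}) d (w : Y -> R) :
  (forall e, eqc_on d A [set y in B | Num.sg (w y) == e] M) ->
  eqc_on (split3_cost d) A B M.
Proof.
move=> h; apply: (@eqc_on_splitY _ _ _ _ _ _ _ (fun x => Num.sg (w x) == 1)) => //.
apply: (@eqc_on_splitY _ _ _ _ _ _ _ (fun x => Num.sg (w x) == -1)).
  by apply: eqc_onS (h (-1)) => //; apply/subsetP => x; rewrite !inE => /andP[/andP[-> _] ->].
apply: eqc_onS (h 0) => //; apply/subsetP => x; rewrite !inE => /andP[/andP[->]].
by case: (sg_cases (w x)) => [->|[->|->]]; rewrite eqxx.
Qed.

(* Once the signs of u2 and v1 are known, scaling rows and columns by positive
   factors turns the form into f x * g y + b x + c y: points against lines. *)
Lemma eqc_bilinear3 k : exists d, forall (X Y : finType)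
    (u0 u1 u2 : X -> R) (v0 v1 v2 : Y -> R) (M : X -> Y -> bool),
  (forall x y, M x y = (0 < u0 x * v0 y + u1 x * v1 y + u2 x * v2 y)) ->
  ~ chain M k -> eqc d M.
Proof.
have [d Hd] := eqc_on_ordered k; exists (split3_cost (split3_cost d)).
move=> X Y u0 u1 u2 v0 v1 v2 M ME nch.
suff [N hN NE] : eqc_on (split3_cost (split3_cost d)) setT setT M.
  by apply: eqc_ext hN => x y; apply: NE.
apply: (@eqc_on_sgX _ _ _ _ _ _ u2) => e1; apply: (@eqc_on_sgY _ _ _ _ _ _ v1) => e2.
(* The value 1 at zero keeps the scaling factor positive, while sign times factor still gives
   [z]. *)
pose nrm (z : R) := if z == 0 then 1 else `|z|.
have nrm_gt0 z : 0 < nrm z.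
  by rewrite /nrm; case: eqVneq => // z0; rewrite normr_gt0.
have nrmE z : Num.sg z * nrm z = z.
  rewrite /nrm; case: eqVneq => [->|z0]; first by rewrite sgr0 mul0r.
  by rewrite mulr_sg_norm.
pose f x := u0 x / nrm (u2 x); pose g y := v0 y / nrm (v1 y).
pose b x := u1 x / nrm (u2 x) * e2; pose c y := v2 y / nrm (v1 y) * e1.
have E x y : x \in [set x in setT | Num.sg (u2 x) == e1] ->
    y \in [set y in setT | Num.sg (v1 y) == e2] -> M x y = (0 < f x * g y + b x + c y).
  rewrite !inE /= => /eqP xe /eqP ye; rewrite ME.
  rewrite -(pmulr_rgt0 (f x * g y + b x + c y) (mulr_gt0 (nrm_gt0 (u2 x)) (nrm_gt0 (v1 y)))).
  congr (0 < _).
  have n1 : nrm (u2 x) != 0 by rewrite gt_eqF.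
  have n2 : nrm (v1 y) != 0 by rewrite gt_eqF.
  rewrite /f /g /b /c -[in LHS](nrmE (u2 x)) -[in LHS](nrmE (v1 y)) xe ye.
  by field; rewrite n1 n2.
apply: (Hd _ _ _ f g) => // x1 x2 y1 y2 x1A x2A y1B y2B.
rewrite !E // -!leNgt => M11 M22 M12 M21 fx gy.
(* In the two positive values minus the two others, [b] and [c] cancel. What is left is positive,
   yet it is the opposite of this product. *)
have : 0 <= (f x2 - f x1) * (g y1 - g y2) by rewrite mulr_ge0 // subr_ge0.
lra.
Qed.

Lemma sqr_lt_conv (l p q r s : R) : 0 <= l -> l <= 1 ->
  p ^+ 2 + q ^+ 2 < 4 -> r ^+ 2 + s ^+ 2 < 4 ->
  (l * p + (1 - l) * r) ^+ 2 + (l * q + (1 - l) * s) ^+ 2 < 4.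
Proof.
move=> l0 l1 pq rs.
have -> : (l * p + (1 - l) * r) ^+ 2 + (l * q + (1 - l) * s) ^+ 2 =
    l * (p ^+ 2 + q ^+ 2) + (1 - l) * (r ^+ 2 + s ^+ 2)
    - l * (1 - l) * ((p - r) ^+ 2 + (q - s) ^+ 2) by ring.
have h : 0 <= l * (1 - l) * ((p - r) ^+ 2 + (q - s) ^+ 2).
  by rewrite !mulr_ge0 ?subr_ge0 // addr_ge0 ?sqr_ge0.
move: l0; rewrite le_eqVlt => /orP[/eqP l0|l0]; first by rewrite -l0 in h *; lra.
have h1 : l * (p ^+ 2 + q ^+ 2) < l * 4 by rewrite ltr_pM2l.
have h2 : (1 - l) * (r ^+ 2 + s ^+ 2) <= (1 - l) * 4 by rewrite ler_wpM2l ?subr_ge0 // ltW.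
lra.
Qed.

Lemma lt_sqr_ge0 (a b z : R) : 0 <= b -> a ^+ 2 + z ^+ 2 < 4 -> 4 <= b ^+ 2 + z ^+ 2 -> a < b.
Proof.
move=> b0 az bz; rewrite ltNge; apply/negP => ba.
have : b ^+ 2 <= a ^+ 2 by rewrite ler_sqr ?nnegrE // (le_trans b0).
lra.
Qed.

(* Circles of equal radius whose centres lie on one side of a line cross at most
   once on the other side. *)
Lemma disk_pattern (u1 v1 u2 v2 s1 w1 s2 w2 : R) :
  u1 <= s1 -> u1 <= s2 -> u2 <= s1 -> u2 <= s2 ->
  (u1 - s1) ^+ 2 + (v1 - w1) ^+ 2 < 4 -> (u2 - s2) ^+ 2 + (v2 - w2) ^+ 2 < 4 ->
  4 <= (u1 - s2) ^+ 2 + (v1 - w2) ^+ 2 -> 4 <= (u2 - s1) ^+ 2 + (v2 - w1) ^+ 2 ->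
  v1 <= v2 -> w2 <= w1 -> False.
Proof.
move=> us11 us12 us21 us22 M11 M22 M12 M21 v12 w21.
(* The crossed height differences are convex combinations of the uncrossed ones, with weights [l]
   and [1 - l] exchanged. As the disk is convex, each crossed horizontal difference exceeds the same
   combination; the sum of both is absurd. *)
suff [l [l0 l1 lE]] : exists l, [/\ 0 <= l, l <= 1 &
    w2 - v1 = l * (w1 - v1) + (1 - l) * (w2 - v2)].
  have lE' : w1 - v2 = (1 - l) * (w1 - v1) + (1 - (1 - l)) * (w2 - v2) by lra.
  have N11 : (s1 - u1) ^+ 2 + (w1 - v1) ^+ 2 < 4 by rewrite -(opprB u1) -(opprB v1) !sqrrN.
  have N22 : (s2 - u2) ^+ 2 + (w2 - v2) ^+ 2 < 4 by rewrite -(opprB u2) -(opprB v2) !sqrrN.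
  have N12 : 4 <= (s2 - u1) ^+ 2 + (w2 - v1) ^+ 2 by rewrite -(opprB u1) -(opprB v1) !sqrrN.
  have N21 : 4 <= (s1 - u2) ^+ 2 + (w1 - v2) ^+ 2 by rewrite -(opprB u2) -(opprB v2) !sqrrN.
  have h1 := sqr_lt_conv l0 l1 N11 N22; rewrite -lE in h1.
  have l0' : 0 <= 1 - l by rewrite subr_ge0.
  have l1' : 1 - l <= 1 by rewrite gerBl.
  have h2 := sqr_lt_conv l0' l1' N11 N22; rewrite -lE' in h2.
  have k1 := @lt_sqr_ge0 _ (s2 - u1) _ _ h1 N12.
  have k2 := @lt_sqr_ge0 _ (s1 - u2) _ _ h2 N21.
  have := k1 _; have := k2 _; rewrite !subr_ge0 => /(_ us21) k2' /(_ us12) k1'.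
  lra.
have [e|ne] := eqVneq (w1 - v1) (w2 - v2); first by exists 0; split=> //; lra.
have pos : 0 < (w1 - v1) - (w2 - v2) by rewrite lt_neqAle eq_sym subr_eq0 ne /=; lra.
exists ((v2 - v1) / ((w1 - v1) - (w2 - v2))); split.
- by apply: divr_ge0; [rewrite subr_ge0 | apply: ltW].
- by rewrite ler_pdivrMr // mul1r; lra.
- by field; rewrite gt_eqF.
Qed.

Lemma eqc_on_separated k : exists d, forall (X Y : finType) (M : X -> Y -> bool)
    (u v : X -> R) (s w : Y -> R) (A : {set X}) (B : {set Y}),
  ~ chain M k ->
  (forall x y, M x y = ((u x - s y) ^+ 2 + (v x - w y) ^+ 2 < 4)) ->
  (forall x y, x \in A -> y \in B -> u x <= s y) -> eqc_on d A B M.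
Proof.
have [d Hd] := eqc_on_ordered k; exists d => X Y M u v s w A B nch ME us.
apply: (Hd _ _ _ v w) => // x1 x2 y1 y2 x1A x2A y1B y2B.
by rewrite !ME -!leNgt; apply: disk_pattern; apply: us.
Qed.

Lemma norm2_lt2 (v : 'rV[R]_2) : (norm2 v < 2) = (v 0 0 ^+ 2 + v 0 1 ^+ 2 < 4).
Proof.
rewrite /norm2 big_ord_recl big_ord1.
have -> : (2 : R) = Num.sqrt (2 ^+ 2) by rewrite sqrtr_sqr ger0_norm.
rewrite ltr_sqrt ?exprn_gt0 //.
have -> : lift 0 0 = 1 :> 'I_2 by apply/val_inj.
by have -> : (2 : R) ^+ 2 = 4 by ring.
Qed.

(** Points at distance below 2 have unit cells whose indices differ by at most 2, and points in a
    common cell are always that close. *)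
Definition cell_shifts : seq (int * int) :=
  [seq (i, j) | i <- [:: -2; -1; 0; 1; 2], j <- [:: -2; -1; 0; 1; 2]].

Lemma floor_near (p q : R) : (p - q) ^+ 2 < 4 ->
  Num.floor q - Num.floor p \in [:: -2; -1; 0; 1; 2].
Proof.
move=> pq.
have [lo hi] : q < p + 2 /\ p < q + 2.
  have : `|p - q| < 2.
    rewrite -(@ltr_pXn2r _ 2) ?nnegrE // real_normK ?num_real //.
    by have -> : (2 : R) ^+ 2 = 4 by ring.
  by rewrite ltr_norml => /andP[? ?]; split; lra.
have /andP[p1 p2] := floor_itv p; have /andP[q1 q2] := floor_itv q.
have h1 : Num.floor q < Num.floor p + 3.
  by rewrite -(ltr_int R); rewrite !intrD in p2 q2 *; lra.
have h2 : Num.floor p < Num.floor q + 3.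
  by rewrite -(ltr_int R); rewrite !intrD in p2 q2 *; lra.
rewrite !inE; move: (Num.floor p) (Num.floor q) h1 h2 => i j; clear; lia.
Qed.

Lemma floor_gap (p q : R) : Num.floor p < Num.floor q -> p <= q.
Proof.
move=> pq; have /andP[_ p2] := floor_itv p; have /andP[q1 _] := floor_itv q.
apply: ltW; apply: lt_le_trans p2 _; apply: le_trans q1.
by rewrite ler_int lezD1.
Qed.

Lemma floor_same (p q : R) : Num.floor q = Num.floor p -> (p - q) ^+ 2 < 1.
Proof.
move=> e; have /andP[p1 p2] := floor_itv p; have /andP[q1 q2] := floor_itv q.
rewrite e in q1 q2; rewrite !intrD in p2 q2.
rewrite -real_normK ?num_real // expr_lt1 // ltr_norml; lra.
Qed.

(** For each shift between cells, a nonzero coordinate separates the centres by an axis-parallel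
    line; reflections and swapping coordinates reduce to [eqc_on_separated]. The zero shift gives
    only ones. *)
Lemma eqc_unit_disk k : exists d, forall (X Y : finType)
    (p : X -> 'rV[R]_2) (q : Y -> 'rV[R]_2),
  let M x y := norm2 (p x - q y) < 2 in ~ chain M k -> eqc d M.
Proof.
have [d Hd] := eqc_on_separated k; exists (size cell_shifts * (1 + d.+1))%N.
move=> X Y p q M nch.
have ME x y : M x y =
    ((p x 0 0 - q y 0 0) ^+ 2 + (p x 0 1 - q y 0 1) ^+ 2 < 4).
  by rewrite /M norm2_lt2 !mxE.
pose fx i x := Num.floor (p x 0 i); pose fy i y := Num.floor (q y 0 i).
pose bx (t : int * int) x := pickle (fx 0 x + t.1, fx 1 x + t.2).
pose bY y := pickle (fy 0 y, fy 1 y).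
have sep t i : eqc_on d [set x in setT | bx t x == i] [set y in setT | bY y == i] M.
  have shift x y : x \in [set x in setT | bx t x == i] ->
      y \in [set y in setT | bY y == i] -> fy 0 y = fx 0 x + t.1 /\ fy 1 y = fx 1 x + t.2.
    rewrite !inE /= => /eqP<- /eqP.
    by move=> /(congr1 (@unpickle (int * int)%type)); rewrite !pickleK => -[-> ->].
  have [t1|t1|t1] := ltgtP t.1 0.
  - apply: (Hd _ _ _ (fun x => - p x 0 0) (fun x => p x 0 1)
                     (fun y => - q y 0 0) (fun y => q y 0 1)) => // x y.
      by rewrite ME; congr (_ < _); ring.
    by move=> xA /(shift x _ xA)[e _]; rewrite lerN2 floor_gap // -/(fx _ _) -/(fy _ _); lia.
  - apply: (Hd _ _ _ (fun x => p x 0 0) (fun x => p x 0 1)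
                     (fun y => q y 0 0) (fun y => q y 0 1)) => // x y.
    by move=> xA /(shift x _ xA)[e _]; rewrite floor_gap // -/(fx _ _) -/(fy _ _); lia.
  have [t2|t2|t2] := ltgtP t.2 0.
  - apply: (Hd _ _ _ (fun x => - p x 0 1) (fun x => p x 0 0)
                     (fun y => - q y 0 1) (fun y => q y 0 0)) => // x y.
      by rewrite ME; congr (_ < _); ring.
    by move=> xA /(shift x _ xA)[_ e]; rewrite lerN2 floor_gap // -/(fx _ _) -/(fy _ _); lia.
  - apply: (Hd _ _ _ (fun x => p x 0 1) (fun x => p x 0 0)
                     (fun y => q y 0 1) (fun y => q y 0 0)) => // x y.
      by rewrite ME addrC.
    by move=> xA /(shift x _ xA)[_ e]; rewrite floor_gap // -/(fx _ _) -/(fy _ _); lia.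
  exists (fun _ _ => true) => [|x y xA yB]; first exact: eqc_const.
  apply/esym; rewrite ME; have [] := shift x y xA yB; rewrite t1 t2 !addr0 /fx /fy => e0 e1.
  have n0 := floor_same e0; have n1 := floor_same e1; lra.
have /choice[N NP] : forall t, exists N, eqc d.+1 N /\
    forall x y, bx t x = bY y -> N x y = M x y.
  move=> t; have [N hN NE] := eqc_on_blocks (sep t).
  by exists N; split=> // x y; apply: NE; rewrite inE.
apply: (@eqc_ext _ _ _ (fun x y => has (fun t => (bx t x == bY y) && N t x y) cell_shifts)).
  move=> x y; apply/hasP/idP => [[t _ /andP[/eqP txy]]|Mxy].
    by have [_ ->] := NP t.
  exists (fy 0 y - fx 0 x, fy 1 y - fx 1 x).
    rewrite ME in Mxy.
    have s0 := sqr_ge0 (p x 0 0 - q y 0 0); have s1 := sqr_ge0 (p x 0 1 - q y 0 1).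
    by apply: allpairs_f; apply: floor_near; lra.
  have e : bx (fy 0 y - fx 0 x, fy 1 y - fx 1 x) x = bY y.
    by rewrite /bx /bY /= !(addrC (fx _ x)) !subrK.
  by rewrite e eqxx; have [_ ->] := NP (fy 0 y - fx 0 x, fy 1 y - fx 1 x).
apply: eqc_has => t; apply: eqc_and; first exact: eqc_eq.
by have [] := NP t.
Qed.

End Geometry.

(** * Half-graphs and graph classes *)

(** Pairing the row of one element with the column of the next puts ones on the diagonal, for half
    the length. *)
Lemma chain_thin (X Y : finType) (M : X -> Y -> bool) n : chain M n.*2 ->
  exists s : seq (X * Y),
    [/\ size s = n, pairwise (chain_rel M) s & all (fun u => M u.1 u.2) s].
Proof.
move=> [s sn ps]; suff [t [tn pt dt _]] : exists t : seq (X * Y),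
    [/\ size t = n, pairwise (chain_rel M) t, all (fun u => M u.1 u.2) t &
     forall w, w \in t -> exists2 u, u \in s & exists2 v, v \in s & w = (u.1, v.2)].
  by exists t.
elim: n s sn ps => [|n IHn] [|u [|v s]] //=; first by exists [::].
move=> [sn] /andP[/andP[uv /allP us] /andP[/allP vs ps]].
have [t [tn pt dt ts]] := IHn s sn ps; exists ((u.1, v.2) :: t).
split; rewrite /= ?tn // ?pt ?dt ?andbT.
- apply/allP => w /ts[u' u's [v' v's ->]].
  have /andP[Muv _] := us v' v's; have /andP[_ Mvu] := vs u' u's.
  by rewrite /chain_rel Muv.
- by have /andP[] := uv.
- move=> w; rewrite inE => /orP[/eqP->|/ts[u' u's [v' v's ->]]].
    by exists u; rewrite ?inE ?eqxx //; exists v; rewrite // !inE eqxx orbT.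
  by exists u'; rewrite ?inE ?u's ?orbT //; exists v'; rewrite // !inE v's !orbT.
Qed.

Section ChainIndex.
Variables (V : finType) (e : rel V).

Lemma has_chain_seq k (s : seq (V * V)) : symmetric e -> size s = k ->
  pairwise (chain_rel e) s -> uniq (unzip1 s ++ unzip2 s) -> has_chain e k.
Proof.
move=> esym sk ps us.
have s1 : size (unzip1 s) == k by rewrite size_map sk.
have s2 : size (unzip2 s) == k by rewrite size_map sk.
apply/existsP; exists (Tuple s1); apply/existsP; exists (Tuple s2); rewrite us /=.
apply/forallP => i; apply/forallP => j; apply/implyP => ij.
have x0 : V := tnth (Tuple s1) i.
rewrite !(tnth_nth x0) /= !(nth_map (x0, x0)) ?sk //.
rewrite (esym (nth _ s i).2); move/(pairwiseP (x0, x0)): ps => ps.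
by apply: (ps i j) => //; rewrite inE sk.
Qed.

(* A vertex may occur both as a row and as a column of a chain, but not in both
   halves of it, since e is symmetric. *)
Lemma has_chain_of_chain (M : V -> V -> bool) k : symmetric e ->
  (forall x y, x != y -> M x y = e x y) -> chain M k.*2.*2 -> has_chain e k.
Proof.
move=> esym ME /chain_thin[s [sk ps ds]].
pose s1 := take k s; pose s2 := drop k s.
have s12 : s = s1 ++ s2 by rewrite cat_take_drop.
have sz1 : size s1 = k by rewrite size_takel // sk -addnn leq_addr.
have sz2 : size s2 = k by rewrite size_drop sk -addnn addnK.
move: ps ds; rewrite s12 pairwise_cat all_cat => /and3P[/allrelP r12 p1 p2] /andP[d1 d2].
(* In a half with disjoint rows and columns [M] agrees with [e], and the ones on the diagonal force
   distinct rows and distinct columns. *)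
have good t : size t = k -> pairwise (chain_rel M) t -> all (fun u => M u.1 u.2) t ->
    ~~ has (mem (unzip1 t)) (unzip2 t) -> has_chain e k.
  move=> tk pt dt hn.
  have allt : all (mem t) t by apply/allP.
  apply: (has_chain_seq esym tk).
    apply: sub_in_pairwise allt pt => u v ut vt /=.
    have ne (w w' : V * V) : w \in t -> w' \in t -> w.1 != w'.2.
      move=> wt w't; apply: contraNneq hn => ww'; apply/hasP; exists w'.2.
        exact: map_f.
      by rewrite /= -ww' map_f.
    by rewrite /chain_rel !ME ?ne.
  have tdiag : {in t &, forall u v, chain_rel M u v -> u.1 != v.1 /\ u.2 != v.2}.
    move=> u v /(allP dt) Mu /(allP dt) Mv /andP[_ Mvu]; split.
      by apply: contraNneq Mvu => <-.
    by apply: contraNneq Mvu => ->.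
  rewrite cat_uniq hn !uniq_pairwise !pairwise_map /=; apply/andP; split.
    by apply: sub_in_pairwise allt pt => u v ut vt /tdiag[].
  by apply: sub_in_pairwise allt pt => u v ut vt /tdiag[].
have [/hasP[x /mapP[v vs1 xv] /mapP[u us1 xu]]|h1] :=
  boolP (has (mem (unzip1 s1)) (unzip2 s1)); last exact: (good s1).
have [/hasP[x' /mapP[v' vs2 xv'] /mapP[u' us2 xu']]|h2] :=
  boolP (has (mem (unzip1 s2)) (unzip2 s2)); last exact: (good s2).
(* Now each half has a vertex that is both a row and a column. The entry of these two vertices is 1
   in one order and 0 in the other. *)
have /andP[Muv' Mv'u] := r12 u v' us1 vs2.
have /andP[_ Mu'v] := r12 v u' vs1 us2.
have /andP[_ Mu'u] := r12 u u' us1 us2.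
have Mu := allP d1 u us1.
have ne : u.1 != u'.1 by apply: contraNneq Mu'u => <-.
have e1 : e u.1 u'.1 by rewrite -ME // -xu' xv'.
by move: Mu'v; rewrite -xv xu ME 1?eq_sym // esym e1.
Qed.

Lemma has_chain_index k : has_chain e k -> k <= chain_index e.
Proof.
move=> hk; have kV : k < #|V|.+1.
  case/existsP: hk => a /existsP[b /andP[/card_uniqP + _]].
  rewrite size_cat !size_tuple ltnS => kk.
  by apply: (@leq_trans (k + k)); [apply: leq_addr | rewrite -kk max_card].
by rewrite /chain_index (bigD1 (Ordinal kV)) //= leq_maxl.
Qed.

Lemma chain_index_leP c : (forall k, has_chain e k -> k <= c) -> chain_index e <= c.
Proof. by move=> h; apply/bigmax_leqP => k /h. Qed.

Lemma chain_index_chain (M : V -> V -> bool) k : symmetric e ->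
  (forall x y, x != y -> M x y = e x y) -> chain_index e <= k ->
  ~ chain M k.+1.*2.*2.
Proof.
move=> esym ME ek /(has_chain_of_chain esym ME)/has_chain_index.
by rewrite leqNgt ltnS ek.
Qed.

End ChainIndex.

Lemma edge_sym n (G : sgraph n) : symmetric (edge G).
Proof.
move=> x y; rewrite /edge; case: G => A /= /andP[/forallP sA _].
by have /forallP/(_ y)/eqP := sA x.
Qed.

Lemma edge_irr n (G : sgraph n) x : edge G x x = false.
Proof. by rewrite /edge; case: G => A /= /andP[_ /forallP/(_ x)/negbTE]. Qed.

Lemma biedge_sym m n (G : bigraph m n) : symmetric (biedge G).
Proof. by case=> x [] y. Qed.

Lemma biedge_irr m n (G : bigraph m n) u : biedge G u u = false.
Proof. by case: u. Qed.

Lemma chain_biedge m n (G : bigraph m n) k :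
  chain (fun x y => G x y) k -> chain (biedge G) k.
Proof.
move=> [s sk ps]; exists [seq (inl u.1, inr u.2) | u <- s]; first by rewrite size_map.
by rewrite pairwise_map.
Qed.

Lemma eqc_bigraph d m n (G : bigraph m n) :
  eqc d (fun x y => G x y) -> eqc (2 + (d + (2 + (d + 0)))) (biedge G).
Proof.
move=> hG.
pose l (u : 'I_m + 'I_n) := if u is inl x then Some x else None.
pose r (u : 'I_m + 'I_n) := if u is inr y then Some y else None.
have [N hN NE] := eqc_partial l r hG.
have [N' hN' N'E] := eqc_partial r l (eqc_swap hG).
have c b b' : eqc 2 (fun u v : 'I_m + 'I_n => (isSome (l u) == b) && (isSome (l v) == b')).
  apply: (@eqc_and _ _ 1 1); first exact: (eqc_rows _ (fun u => isSome (l u) == b)).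
  exact: (eqc_cols _ (fun v => isSome (l v) == b')).
have h1 := eqc_and (c true false) hN; have h2 := eqc_and (c false true) hN'.
have := eqc_or h1 h2; rewrite -!addnA addn0; apply: eqc_ext => -[x|y] [x'|y'] //=.
  by rewrite (NE _ _ x y') ?orbF.
by rewrite (N'E _ _ y x').
Qed.

(** * Decision trees for stable graphs of either kind *)

Section SmallClasses.
Variable R : realType.
Local Open Scope ring_scope.

Lemma rank_le3 m n (A : 'M[R]_(m, n)) : (\rank A <= 3)%N ->
  exists (u : 'I_3 -> 'I_m -> R) (v : 'I_3 -> 'I_n -> R),
    forall x y, A x y = \sum_i u i x * v i y.
Proof.
move=> rA; pose P : 'M[R]_(m, 3) := pid_mx (\rank A).
pose Q : 'M[R]_(3, n) := pid_mx (\rank A).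
exists (fun i x => (col_ebase A *m P) x i), (fun i y => (Q *m row_ebase A) i y).
move=> x y; have E : A = (col_ebase A *m P) *m (Q *m row_ebase A).
  rewrite mulmxA -(mulmxA _ P) mul_pid_mx.
  by rewrite minnn (minn_idPr rA) mulmx_ebase.
by rewrite [in LHS]E mxE.
Qed.

Lemma eqc_rank3 k : exists d, forall m n (A : 'M[R]_(m, n)),
  (\rank A <= 3)%N -> ~ chain (fun x y => 0 < A x y) k ->
  eqc d (fun x y => 0 < A x y).
Proof.
have [d Hd] := eqc_bilinear3 R k; exists d => m n A /rank_le3[u [v AE]].
apply: (Hd _ _ (u 0) (u 1) (u (inord 2)) (v 0) (v 1) (v (inord 2))) => x y.
rewrite AE !big_ord_recl big_ord0 addr0 addrA.
have -> : lift 0 0 = 1 :> 'I_3 by apply/val_inj.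
by have -> : lift 0 (lift 0 0) = inord 2 :> 'I_3 by apply/val_inj; rewrite /= inordK.
Qed.

Lemma sg_pm1_gt0 (z : R) b : Num.sg z = pm1 R b -> (0 < z) = b.
Proof. by rewrite -sgr_cp0 => ->; case: b; rewrite /pm1 ?eqxx // eqNr oner_eq0. Qed.

(** A representing matrix is unconstrained on the diagonal; one equality test on vertices resets it
    to 0. *)
Lemma eqc_offdiag d (V : finType) (e : rel V) (M : V -> V -> bool) :
  (forall x, e x x = false) -> (forall x y, x != y -> M x y = e x y) ->
  eqc d M -> eqc (1 + d) e.
Proof.
move=> eirr ME hM.
apply: eqc_ext (eqc_and (eqc_negb (eqc_eq (@enum_rank V) (@enum_rank V))) hM).
move=> x y; rewrite (inj_eq val_inj) (inj_eq enum_rank_inj).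
by case: eqVneq => [->|/ME->]; rewrite ?eirr.
Qed.

Lemma eqc_sign_rank k : exists d, forall n (G : sgraph n),
  (sign_rank R G <= 3)%N -> (chain_index (edge G) <= k)%N -> eqc d (edge G).
Proof.
have [d Hd] := eqc_rank3 k.+1.*2.*2; exists (1 + d)%N => n G.
rewrite /sign_rank; case: ex_minnP => r /asboolP[A [GA Ar]] _ r3 Gk.
have AE x y : x != y -> (0 < A x y) = edge G x y by move=> /GA/sg_pm1_gt0.
apply: eqc_offdiag (AE) _; first exact: edge_irr.
apply: Hd; first by rewrite Ar.
exact: chain_index_chain (@edge_sym _ G) AE Gk.
Qed.

Lemma eqc_unit_disk_rel k : exists d, forall (V : finType) (e : rel V),
  symmetric e -> (forall x, e x x = false) -> unit_disk R e ->
  (chain_index e <= k)%N -> eqc d e.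
Proof.
have [d Hd] := eqc_unit_disk R k.+1.*2.*2; exists (1 + d)%N => V e esym eirr [phi phiE] ek.
have ME x y : x != y -> (norm2 (phi x - phi y) < 2) = e x y by move=> /phiE.
apply: eqc_offdiag (ME) _ => //; apply: (Hd _ _ phi phi).
exact: chain_index_chain esym ME ek.
Qed.

Lemma eqc_bisign_rank k : exists d, forall m n (G : bigraph m n),
  (bisign_rank R G <= 3)%N -> (chain_index (biedge G) <= k)%N -> eqc d (biedge G).
Proof.
have [d Hd] := eqc_rank3 k.+1.*2.*2.
exists (2 + (d + (2 + (d + 0))))%N => m n G.
rewrite /bisign_rank; case: ex_minnP => r /asboolP[A [GA Ar]] _ r3 Gk.
apply: eqc_bigraph; have AE x y : (0 < A x y) = G x y by exact/sg_pm1_gt0.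
apply: (eqc_ext AE); apply: Hd; first by rewrite Ar.
have -> : (fun x y => 0 < A x y) = (fun x y => G x y).
  by apply/funext => x; apply/funext => y.
by move=> /chain_biedge; apply: chain_index_chain Gk => //; apply: biedge_sym.
Qed.

End SmallClasses.

(** * Randomized protocols and labels *)

Section Hashing.
Variables X Y : finType.

Fixpoint eq_test (f : X -> nat) (g : Y -> nat) (s : seq nat) (p0 p1 : protocol X Y) :=
  if s is c :: s' then
    Alice (fun x => f x == c) (eq_test f g s' p0 p1) (Bob (fun y => g y == c) p0 p1)
  else p0.

Lemma run_eq_test f g s p0 p1 x y : f x \in s ->
  run (eq_test f g s p0 p1) x y = if f x == g y then run p1 x y else run p0 x y.
Proof.
elim: s => //= c s IHs; rewrite inE; case: eqVneq => [-> _|_ /= /IHs //].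
by rewrite eq_sym.
Qed.

Lemma cost_eq_test f g s p0 p1 c : cost p0 <= c -> cost p1 <= c ->
  cost (eq_test f g s p0 p1) <= size s + c.+1.
Proof.
move=> h0 h1; elim: s => [|z s IHs] /=; first exact: leqW.
rewrite addSn ltnS geq_max IHs /= (leq_trans _ (leq_addl _ _)) // ltnS.
by rewrite geq_max h0.
Qed.

(** Equal values have equal hashes, so an error needs a collision at one of the at most [d] failed
    tests on the path of [(x, y)]; [L] lists them. The bound [V] makes the domain of the hash
    functions finite. *)
Lemma eqc_hash d (M : X -> Y -> bool) : eqc d M ->
  exists (P : nat -> (nat -> nat) -> protocol X Y) (V : nat),
    (forall K h, cost (P K h) <= d * K.+1) /\
    forall x y, exists L : seq (nat * nat),
      [/\ size L <= d, all (fun p => [&& p.1 != p.2, p.1 < V & p.2 < V]) L &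
        forall K h, (forall i, h i < K) -> all (fun p => h p.1 != h p.2) L ->
          run (P K h) x y = M x y].
Proof.
elim: d M => [M [b Mb]|d IHd M [f [g [M0 [M1]]]]].
  by exists (fun _ _ => Output b), 0; split=> // x y; exists [::]; split=> // K h _ _; rewrite Mb.
move=> [/IHd[P0 [V0 [c0 h0]]] /IHd[P1 [V1 [c1 h1]]] ME].
pose F := \max_x f x; pose G := \max_y g y.
exists (fun K h => eq_test (h \o f) (h \o g) (iota 0 K) (P0 K h) (P1 K h)).
exists (V0 + V1 + F.+1 + G.+1); split=> [K h|x y].
  apply: leq_trans (cost_eq_test _ _ _ (c0 K h) (c1 K h)) _.
  by rewrite size_iota mulSn addSn addnS.
have lift V (L : seq (nat * nat)) : V <= V0 + V1 ->
    all (fun p => [&& p.1 != p.2, p.1 < V & p.2 < V]) L ->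
    all (fun p => [&& p.1 != p.2, p.1 < V0 + V1 + F.+1 + G.+1 &
                      p.2 < V0 + V1 + F.+1 + G.+1]) L.
  move=> hV; have hV' : V <= V0 + V1 + F.+1 + G.+1.
    by apply: leq_trans hV _; rewrite -(addnA (V0 + V1)) leq_addr.
  by apply: sub_all => p /and3P[-> h2 h3] /=; rewrite (leq_trans h2) ?(leq_trans h3).
have [fg|fg] := eqVneq (f x) (g y).
  have [L [sL aL hL]] := h1 x y; exists L; split; first exact: leqW.
    by apply: lift aL; apply: leq_addl.
  move=> K h hK hh; rewrite run_eq_test ?mem_iota //= ?hK // ME fg !eqxx.
  exact: hL.
have [L [sL aL hL]] := h0 x y; exists ((f x, g y) :: L); split=> //=.
  rewrite fg (lift V0) ?leq_addr // andbT.
  have fF : f x <= F by apply: leq_bigmax.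
  have gG : g y <= G by apply: leq_bigmax.
  lia.
move=> K h hK /andP[hfg hh]; rewrite run_eq_test ?mem_iota //= ?hK // ME.
by rewrite (negbTE hfg) (negbTE fg); apply: hL.
Qed.

End Hashing.

(** Overwriting the value at [p] loses nothing, as it is also stored at [q]: a collision has
    probability at most [1 / K]. *)
Lemma card_collision V K (p q : 'I_V) : p != q ->
  K * #|[set w : {ffun 'I_V -> 'I_K} | w p == w q]| <= #|{ffun 'I_V -> 'I_K}|.
Proof.
move=> pq; set E := [set w | _].
pose T (cw : 'I_K * {ffun 'I_V -> 'I_K}) := [ffun i => if i == p then cw.1 else cw.2 i].
rewrite -[X in X * _]card_ord -cardsT -cardsX -(@card_in_imset _ _ T) ?max_card //.
move=> [c w] [c' w']; rewrite !inE /= => /eqP wE /eqP w'E /ffunP TT.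
have cc : c = c' by have := TT p; rewrite !ffunE eqxx.
have wq i : i != p -> w i = w' i by move=> ip; have := TT i; rewrite !ffunE (negbTE ip).
congr (_, _) => //; apply/ffunP => i.
have [->|/wq //] := eqVneq i p; by rewrite wE w'E wq // eq_sym.
Qed.

Section Upper.
Variable R : realType.
Local Open Scope ring_scope.

Lemma eqc_randomized d m n (M : 'M[bool]_(m, n)) : eqc d (fun x y => M x y) ->
  randomized_protocol_of_cost R M (d * (3 * d).+2)%N.
Proof.
(* By the union bound the error is at most [d / K]; this [K] makes it at most 1/3 and is positive
   even for [d = 0]. *)
move=> /eqc_hash[P [V [Pc PE]]]; pose K := (3 * d).+1.
pose Omega := {ffun 'I_V.+1 -> 'I_K}; pose h (w : Omega) i : nat := w (inord i).
have cO : (0 < #|{: Omega}|)%N by rewrite card_ffun !card_ord expn_gt0.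
exists Omega, (fun=> #|{: Omega}|%:R^-1), (fun w => P K (h w)); split=> //.
- by move=> _; rewrite invr_ge0 ler0n.
- by rewrite sumr_const -[LHS]mulr_natl divff // pnatr_eq0 -lt0n.
move=> x y; rewrite sumr_const -[leRHS]mulr_natl.
have [L [sL aL hL]] := PE x y.
set good := (X in #|X|).
have bad_le : (3 * #|[predC good]| <= #|{: Omega}|)%N.
  have le_sum : (#|[predC good]| <= \sum_(p <- L) #|[set w : Omega | w (inord p.1) == w (inord p.2)]|)%N.
    apply: (@leq_trans #|[set w : Omega | ~~ all (fun p => h w p.1 != h w p.2) L]|).
      apply: subset_leq_card; apply/subsetP => w; rewrite !inE; apply: contra => hw.
      by rewrite unfold_in; apply/eqP; apply: hL => // i; rewrite /h.
    elim: (L) => [|p s IHs]; first by rewrite big_nil leqn0 cards_eq0; apply/eqP/setP => w; rewrite !inE.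
    rewrite big_cons; apply: leq_trans (leq_add (leqnn _) IHs).
    apply: leq_trans (leq_card_setU _ _); apply: subset_leq_card; apply/subsetP => w.
    by rewrite !inE /= negb_and negbK.
  have : (K * #|[predC good]| <= d * #|{: Omega}|)%N.
    apply: (@leq_trans (K * \sum_(p <- L) #|[set w : Omega | w (inord p.1) == w (inord p.2)]|)).
      by rewrite leq_mul2l le_sum orbT.
    rewrite big_distrr /=; apply: (@leq_trans (size L * #|{: Omega}|)); last by rewrite leq_mul2r sL orbT.
    elim: (L) aL => [|p s IHs] /=; first by rewrite big_nil.
    move=> /andP[/and3P[pp p1 p2] /IHs hs]; rewrite big_cons mulSn leq_add //.
    apply: card_collision; rewrite -(inj_eq val_inj) /= !inordK // ltnS; exact: ltnW.
  rewrite /K; move: (#|_|) (#|_|) => b o; nia.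
have gb : (#|good| + #|[predC good]| = #|{: Omega}|)%N := cardC good.
rewrite ler_pdivlMr ?ltr0n // mulrAC ler_pdivrMr ?ltr0n // -!natrM ler_nat.
move: (#|good|) (#|[predC good]|) (#|{: Omega}|) gb bad_le => g b o; lia.
Qed.

Lemma randomized_cc_le d m n (M : 'M[bool]_(m, n)) : eqc d (fun x y => M x y) ->
  (randomized_cc R M <= d * (3 * d).+2)%N.
Proof.
move=> /eqc_randomized hM; rewrite /randomized_cc; case: ex_minnP => c _; apply.
exact/asboolP.
Qed.

End Upper.

(** * Adjacency labels from decision trees *)

Fixpoint label_size d := if d is d'.+1 then 1 + (label_size d' + label_size d') else 1.

(** A label lists the query values of the whole tree in preorder, the subtree for equality first; at
    a leaf the first label holds the output. *)
Fixpoint decode d (a b : seq nat) : bool :=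
  if d is d'.+1 then
    let s := label_size d' in
    if head 0 a == head 0 b then decode d' (take s (behead a)) (take s (behead b))
    else decode d' (drop s (behead a)) (drop s (behead b))
  else head 0 a == 1.

Lemma eqc_labels d (V W : finType) (M : V -> W -> bool) : eqc d M ->
  exists (F : V -> seq nat) (G : W -> seq nat),
    [/\ forall v, size (F v) = label_size d /\ all (fun n => n <= #|V|) (F v),
        forall w, size (G w) = label_size d /\ all (fun n => n <= #|V|) (G w) &
        forall v w, decode d (F v) (G w) = M v w].
Proof.
elim: d M => [M [b Mb]|d IHd M [f [g [M0 [M1]]]]].
  exists (fun=> [:: nat_of_bool b]), (fun=> [:: 0]); split=> //= [v|v w].
    by split=> //; rewrite andbT; apply: leq_trans (leq_b1 b) _; apply/card_gt0P; exists v.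
  by rewrite Mb; case: b {Mb}.
move=> [/IHd[F0 [G0 [hF0 hG0 D0]]] /IHd[F1 [G1 [hF1 hG1 D1]]] ME].
(* Query values become positions among the values of [f], hence small. Values never taken by [f] all
   go to [#|V|], which no [f v] does. *)
pose r n := index n (codom f).
have rV n : r n <= #|V| by rewrite -(size_codom f) index_size.
have rE v w : (r (f v) == r (g w)) = (f v == g w).
  apply/eqP/eqP => [e|->//]; have fin := codom_f f v.
  have gin : g w \in codom f by rewrite -index_mem -[index _ _]e index_mem.
  exact: (index_inj 0 fin gin e).
exists (fun v => r (f v) :: F1 v ++ F0 v), (fun w => r (g w) :: G1 w ++ G0 w); split.
- move=> v; have [s0 a0] := hF0 v; have [s1 a1] := hF1 v.
  by rewrite /= size_cat s0 s1 all_cat a0 a1 rV.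
- move=> w; have [s0 a0] := hG0 w; have [s1 a1] := hG1 w.
  by rewrite /= size_cat s0 s1 all_cat a0 a1 rV.
move=> v w; rewrite ME /= rE.
have [s1 _] := hF1 v; have [t1 _] := hG1 w.
rewrite -{1 3}s1 -{1 2}t1 !take_size_cat // !drop_size_cat //.
by rewrite D0 D1.
Qed.

Fixpoint bits w n := if w is w'.+1 then odd n :: bits w' n./2 else [::].

Fixpoint unbits (s : seq bool) := if s is b :: s' then b + (unbits s').*2 else 0.

Lemma size_bits w n : size (bits w n) = w.
Proof. by elim: w n => //= w IHw n; rewrite IHw. Qed.

Lemma shape_bits w l : shape (map (bits w) l) = nseq (size l) w.
Proof. by elim: l => //= n l ->; rewrite size_bits. Qed.

Lemma bitsK w n : n < 2 ^ w -> unbits (bits w n) = n.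
Proof.
elim: w n => [|w IHw] n /=; first by rewrite expn0 ltnS leqn0 => /eqP.
rewrite expnS => hn; rewrite IHw ?odd_double_half //; lia.
Qed.

Section Encoding.
Variable R : realType.

Lemma log_width_le N : 2 <= N ->
  ((trunc_log 2 N).+1%:R * ln 2 <= 2 * ln N%:R :> R)%R.
Proof.
move=> N2; have ln2 : (0 < ln (2 : R))%R by rewrite ln_gt0 // ltr1n.
have t1 : 0 < trunc_log 2 N by rewrite trunc_log_gt0 N2.
apply: (@le_trans _ _ ((2 * trunc_log 2 N)%:R * ln 2)%R).
  by rewrite ler_pM2r // ler_nat; lia.
rewrite natrM -mulrA ler_pM2l ?ltr0n // mulr_natl -lnXn ?ltr0n //.
rewrite ler_ln ?posrE ?exprn_gt0 ?ltr0n //; last exact: leq_trans N2.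
by rewrite -natrX ler_nat trunc_logP //; apply: leq_trans N2.
Qed.

(** A vertex carries its row label and its column label in words of equal width; the decoder
    recovers the width by dividing the length by the fixed number [s + s] of words. *)
Lemma eqc_encodable d : exists (D : seq bool -> seq bool -> bool) (c : R),
  forall (V : finType) (e : rel V), eqc d e -> encodable D c e.
Proof.
pose s := label_size d.
pose parse l := map unbits (reshape (nseq (s + s) (size l %/ (s + s))) l).
exists (fun l l' => decode d (take s (parse l)) (drop s (parse l'))).
exists ((s + s)%:R * 2 / ln 2)%R => V e /eqc_labels[F [G [hF hG FG]]].
pose w := (trunc_log 2 #|V|).+1.
pose enc v := flatten (map (bits w) (F v ++ G v)).
have s_gt0 : 0 < s + s by rewrite /s; case: (d).
have shapeE v : shape (map (bits w) (F v ++ G v)) = nseq (s + s) w.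
  have [sF _] := hF v; have [sG _] := hG v.
  by rewrite shape_bits size_cat sF sG.
have szE v : size (enc v) = (s + s) * w.
  by rewrite size_flatten shapeE sumn_nseq mulnC.
have parseE v : parse (enc v) = F v ++ G v.
  rewrite /parse szE mulKn // -(shapeE v) flattenK -map_comp map_id_in // => n.
  have [_ /allP aF] := hF v; have [_ /allP aG] := hG v.
  rewrite mem_cat => nFG; apply: bitsK.
  apply: (@leq_ltn_trans #|V|); last exact: trunc_log_ltn.
  by case/orP: nFG => [/aF|/aG].
exists enc; split=> [V2 v|u v].
  rewrite szE natrM -!mulrA ler_pM2l ?ltr0n //.
  have ln2 : (0 < ln (2 : R))%R by rewrite ln_gt0 // ltr1n.
  have := log_width_le V2; rewrite -ler_pdivlMr // => /le_trans; apply.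
  by rewrite mulrAC mulrA.
have [sF _] := hF u; have [sF' _] := hF v.
rewrite !parseE take_size_cat //.
by rewrite drop_size_cat // FG.
Qed.

End Encoding.

(** * Lower bound *)

Section Perceptron.
Variable R : realType.
Local Open Scope ring_scope.

(** One coordinate per leaf of a full tree: the vectors of the subtrees are put side by side, and
    the speaking player erases the half that is not followed. *)
Lemma protocol_factor (X Y : Type) c (p : protocol X Y) : (cost p <= c)%N ->
  exists (u : X -> nat -> R) (v : Y -> nat -> R),
    [/\ forall x i, u x i ^+ 2 <= 1, forall y i, v y i ^+ 2 <= 1 &
      forall x y, \sum_(i < 2 ^ c) u x i * v y i = pm1 R (run p x y)].
Proof.
have c2 k : (2 ^ k.+1 = 2 ^ k + 2 ^ k)%N by rewrite expnS mul2n addnn.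
elim: c p => [|c IHc] p.
  case: p => // b _; exists (fun _ _ => 1), (fun _ _ => pm1 R b); split=> [x i|y i|x y].
  - by rewrite expr1n.
  - by case: b; rewrite /pm1 ?sqrrN expr1n.
  - by rewrite expn0 big_ord1 mul1r.
case: p => [b _|f p0 p1|f p0 p1] /=.
- exists (fun _ i => (i == 0%N)%:R), (fun _ _ => pm1 R b); split=> [x i|y i|x y].
  + by case: eqP => _; rewrite ?expr1n ?expr0n ?ler01.
  + by case: b; rewrite /pm1 ?sqrrN expr1n.
  + have p0 : (0 < 2 ^ c.+1)%N by rewrite expn_gt0.
    rewrite (bigD1 (Ordinal p0)) //= mul1r big1 ?addr0 // => i.
    by rewrite -(inj_eq val_inj) /= => /negbTE->; rewrite mul0r.
- rewrite ltnS geq_max => /andP[/IHc[u0 [v0 [hu0 hv0 E0]]] /IHc[u1 [v1 [hu1 hv1 E1]]]].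
  exists (fun x i => if (i < 2 ^ c)%N then (if f x then 0 else u0 x i)
                     else (if f x then u1 x (i - 2 ^ c)%N else 0)).
  exists (fun y i => if (i < 2 ^ c)%N then v0 y i else v1 y (i - 2 ^ c)%N).
  split=> [x i|y i|x y].
  + by case: ifP => _; case: ifP => _; rewrite ?expr0n ?ler01.
  + by case: ifP.
  + rewrite c2 big_split_ord /=.
    under eq_bigr => i _ do rewrite ltn_ord.
    under [X in _ + X]eq_bigr => i _ do rewrite ltnNge leq_addr /= addKn.
    case: (f x).
      by rewrite big1 ?add0r => [|i _]; rewrite ?E1 ?mul0r.
    by rewrite [X in _ + X]big1 ?addr0 => [|i _]; rewrite ?E0 ?mul0r.
- rewrite ltnS geq_max => /andP[/IHc[u0 [v0 [hu0 hv0 E0]]] /IHc[u1 [v1 [hu1 hv1 E1]]]].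
  exists (fun x i => if (i < 2 ^ c)%N then u0 x i else u1 x (i - 2 ^ c)%N).
  exists (fun y i => if (i < 2 ^ c)%N then (if f y then 0 else v0 y i)
                     else (if f y then v1 y (i - 2 ^ c)%N else 0)).
  split=> [x i|y i|x y].
  + by case: ifP.
  + by case: ifP => _; case: ifP => _; rewrite ?expr0n ?ler01.
  + rewrite c2 big_split_ord /=.
    under eq_bigr => i _ do rewrite ltn_ord.
    under [X in _ + X]eq_bigr => i _ do rewrite ltnNge leq_addr /= addKn.
    case: (f y).
      by rewrite big1 ?add0r => [|i _]; rewrite ?E1 ?mulr0.
    by rewrite [X in _ + X]big1 ?addr0 => [|i _]; rewrite ?E0 ?mulr0.
Qed.

Section Dot.
Variables (I : finType) (mu : I -> R).
Hypothesis mu_ge0 : forall i, 0 <= mu i.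

Definition dot (f g : I -> R) : R := \sum_i mu i * (f i * g i).

Lemma dotC f g : dot f g = dot g f.
Proof. by apply: eq_bigr => i _; rewrite (mulrC (f i)). Qed.

Lemma dot_ge0 f : 0 <= dot f f.
Proof. by apply: sumr_ge0 => i _; rewrite mulr_ge0 // -expr2 sqr_ge0. Qed.

Lemma dotDZr f a g h : dot f (fun i => g i + a * h i) = dot f g + a * dot f h.
Proof. by rewrite /dot mulr_sumr -big_split; apply: eq_bigr => i _ /=; ring. Qed.

Lemma dot_sqrDZ a g h :
  dot (fun i => g i + a * h i) (fun i => g i + a * h i) =
  dot g g + 2 * a * dot g h + a ^+ 2 * dot h h.
Proof. by rewrite dotDZr !(dotC (fun i => _ + _)) !dotDZr (dotC h g); ring. Qed.

Variables (X Y : finType) (M : X -> Y -> bool) (U : X -> I -> R) (V : Y -> I -> R).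
Variables (B : R).
Hypotheses (B_gt0 : 0 < B).
Hypothesis UB : forall x, dot (U x) (U x) <= B.
Hypothesis VB : forall y, dot (V y) (V y) <= B.
Hypothesis UV1 : forall x y, M x y -> 3^-1 <= dot (U x) (V y).
Hypothesis UV0 : forall x y, ~~ M x y -> dot (U x) (V y) <= - 3^-1.

(** Equal to [2 ^ T.+1 - 1]: a pivot with a chain of the previous length on either side. *)
Fixpoint bisect_length T := if T is T'.+1 then (bisect_length T' + (bisect_length T').+1)%N else 1%N.

(* The perceptron plays against binary search: each update is a mistake for
   the whole half of the chain that is kept. *)
Lemma perceptron T (s : seq (X * Y)) (W : I -> R) :
  (bisect_length T <= size s)%N -> pairwise (chain_rel M) s ->
  exists u (W' : I -> R), [/\ u \in s,
    dot (U u.1) W + T%:R * 3^-1 <= dot (U u.1) W' &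
    dot W' W' <= dot W W + T%:R * B].
Proof.
elim: T s W => [|T IHT] s W /=.
  case: s => //= u s _ _; exists u, W; rewrite inE eqxx; split=> //.
    by rewrite mul0r addr0.
  by rewrite mul0r addr0.
move=> szs; set l := bisect_length T in szs *.
have ls : (l < size s)%N by apply: leq_trans szs; rewrite addnS ltnS leq_addr.
case E : (drop l s) => [|z s2].
  by have := congr1 size E; rewrite size_drop /= => /eqP; rewrite subn_eq0 leqNgt ls.
have sE : s = take l s ++ z :: s2 by rewrite -E cat_take_drop.
have sz1 : size (take l s) = l by rewrite size_takel // ltnW.
have sz2 : (l <= size s2)%N.
  by move: szs; rewrite sE size_cat sz1 /= leq_add2l ltnS.
rewrite sE pairwise_cat /= => /and4P[/allrelP r12 p1 /allP rz p2].
have TS : T.+1%:R = T%:R + 1 :> R by rewrite -natr1.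
(* If [W] rejects the pivot column, keep the earlier rows, whose entries there are 1, and add its
   vector; otherwise keep the later rows and subtract it. Either way the cross term in the squared
   norm is at most 0. *)
have [neg|pos] := leP (dot W (V z.2)) 0.
  have [|u [W' [us h1 h2]]] := IHT (take l s) (fun i => W i + 1 * V z.2 i) _ p1.
    by rewrite sz1.
  exists u, W'; split; first by rewrite mem_cat us.
    have /andP[/UV1 h _] := r12 u z us (mem_head _ _).
    by rewrite dotDZr in h1; rewrite TS; lra.
  by rewrite dot_sqrDZ in h2; have := VB z.2; rewrite TS; lra.
have [|u [W' [us h1 h2]]] := IHT s2 (fun i => W i + (-1) * V z.2 i) _ p2; first by [].
exists u, W'; split; first by rewrite mem_cat inE us !orbT.
  have /andP[_ /UV0 h] := rz u us.
  by rewrite dotDZr in h1; rewrite TS; lra.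
by rewrite dot_sqrDZ in h2; have := VB z.2; rewrite TS; lra.
Qed.

Lemma margin_chain T : chain M (bisect_length T) -> T%:R <= 9 * B ^+ 2.
Proof.
move=> [s sT ps]; have [|u [W [_ h1 h2]]] := @perceptron T s (fun=> 0) _ ps.
  by rewrite sT.
have d0 f : dot f (fun=> 0) = 0 by apply: big1 => i _; rewrite !mulr0.
rewrite !d0 !add0r in h1 h2.
(* Cauchy-Schwarz, through the squared norm of [W - lam * U u.1]; this [lam] minimises the resulting
   bound. *)
pose lam := T%:R / (3 * B).
have := dot_ge0 (fun i => W i + (- lam) * U u.1 i); rewrite dot_sqrDZ => h.
have l0 : 0 <= lam by rewrite divr_ge0 ?ler0n // mulr_ge0 // ltW.
have h3 : lam * (T%:R * 3^-1) <= lam * dot W (U u.1).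
  by rewrite ler_wpM2l // dotC.
have h4 : (- lam) ^+ 2 * dot (U u.1) (U u.1) <= lam ^+ 2 * B.
  by rewrite sqrrN ler_wpM2l ?sqr_ge0.
have h5 : lam ^+ 2 * B = lam * (T%:R * 3^-1).
  by rewrite /lam; field; rewrite gt_eqF.
have h6 : lam * (T%:R * 3^-1) <= T%:R * B by lra.
have [->|T0] := eqVneq T 0%N; first by rewrite mulr_ge0 ?sqr_ge0.
have T0' : 0 < T%:R :> R by rewrite ltr0n lt0n.
have e : lam * (T%:R * 3^-1) = T%:R * (T%:R / (9 * B)).
  by rewrite /lam; field; rewrite gt_eqF.
rewrite e ler_pM2l // ler_pdivrMr ?mulr_gt0 // in h6.
by rewrite expr2; lra.
Qed.

End Dot.

(** Success probability at least 2/3 gives an expected sign of margin [2 * (2 / 3) - 1], that is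
    1/3. *)
Lemma sum_pm1 (Omega : finType) (mu : Omega -> R) (P : pred Omega) b :
  \sum_w mu w = 1 -> 2 / 3 <= \sum_(w | P w == b) mu w ->
  if b then 3^-1 <= \sum_w mu w * pm1 R (P w)
  else \sum_w mu w * pm1 R (P w) <= - 3^-1.
Proof.
move=> mu1 mub.
have sgE w : pm1 R (P w) = pm1 R b * (2 * (P w == b)%:R - 1).
  by case: (P w); case: b {mub}; rewrite /pm1 /=; ring.
have E : \sum_w mu w * pm1 R (P w) = pm1 R b * (2 * \sum_(w | P w == b) mu w - 1).
  have -> : \sum_(w | P w == b) mu w = \sum_w mu w * (P w == b)%:R.
    by rewrite big_mkcond; apply: eq_bigr => w _; case: eqP => _; rewrite ?mulr1 ?mulr0.
  transitivity (pm1 R b * (2 * (\sum_w mu w * (P w == b)%:R) - \sum_w mu w)).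
    by rewrite mulr_sumr -sumrB mulr_sumr; apply: eq_bigr => w _; rewrite sgE; ring.
  by rewrite mu1.
by rewrite E; case: b {sgE E} mub => mub; rewrite /pm1; lra.
Qed.

Lemma randomized_chain m n (M : 'M[bool]_(m, n)) c k :
  randomized_protocol_of_cost R M c -> chain (fun x y => M x y) k ->
  (k <= bisect_length (9 * 4 ^ c).+1)%N.
Proof.
move=> [Omega [mu [P [mu0 mu1 Pc PM]]]] [s sk ps]; rewrite leqNgt; apply/negP => lk.
have chT : chain (fun x y => M x y) (bisect_length (9 * 4 ^ c).+1).
  exists (take (bisect_length (9 * 4 ^ c).+1) s); first by rewrite size_takel // sk ltnW.
  by move: ps; rewrite -{1}[s](cat_take_drop (bisect_length (9 * 4 ^ c).+1)) pairwise_cat => /and3P[].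
have /choice[u /choice[v uv]] := fun w => protocol_factor (Pc w).
(* The average over the coins is a single inner product over pairs of a coin and a coordinate.
   Squared norms are at most [2 ^ c], whence the bound [9 * 4 ^ c] on the number of mistakes. *)
pose I : finType := (Omega * 'I_(2 ^ c))%type.
pose nu (i : I) := mu i.1; pose U x (i : I) := u i.1 x i.2; pose V y (i : I) := v i.1 y i.2.
have nu0 i : 0 <= nu i by apply: mu0.
have norm (T : Type) (f : Omega -> T -> nat -> R) z : (forall w x i, f w x i ^+ 2 <= 1) ->
    dot nu (fun i : I => f i.1 z i.2) (fun i : I => f i.1 z i.2) <= 2 ^+ c.
  move=> hf; rewrite /dot -(pair_bigA _ (fun w (i : 'I_(2 ^ c)) => mu w * (f w z i * f w z i))) /=.
  apply: (@le_trans _ _ (\sum_w mu w * 2 ^+ c)); last by rewrite -mulr_suml mu1 mul1r.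
  apply: ler_sum => w _; rewrite -mulr_sumr ler_wpM2l //.
  apply: (@le_trans _ _ (\sum_(i < 2 ^ c) 1)).
    by apply: ler_sum => i _; rewrite -expr2.
  by rewrite sumr_const card_ord natrX.
have dotE x y : dot nu (U x) (V y) = \sum_w mu w * pm1 R (run (P w) x y).
  rewrite /dot -(pair_bigA _ (fun w (i : 'I_(2 ^ c)) => mu w * (u w x i * v w y i))) /=.
  by apply: eq_bigr => w _; rewrite -mulr_sumr; have [_ _ ->] := uv w.
have bnd : 9 * (2 ^+ c) ^+ 2 < ((9 * 4 ^ c).+1)%:R :> R.
  have -> : (2 ^+ c) ^+ 2 = (4 ^ c)%:R :> R.
    by rewrite -exprM mulnC exprM natrX; congr (_ ^+ c); ring.
  by rewrite -natrM ltr_nat.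
suff : (9 * 4 ^ c).+1%:R <= 9 * (2 ^+ c) ^+ 2 :> R by rewrite leNgt bnd.
apply: (@margin_chain I nu nu0 _ _ (fun x y => M x y) U V (2 ^+ c)) chT.
- by rewrite exprn_gt0.
- by move=> x; apply: norm => w z i; have [] := uv w.
- by move=> y; apply: norm => w z i; have [] := uv w.
- by move=> x y Mxy; rewrite dotE; have := sum_pm1 mu1 (PM x y); rewrite Mxy.
- by move=> x y /negbTE Mxy; rewrite dotE; have := sum_pm1 mu1 (PM x y); rewrite Mxy.
Qed.

Lemma randomized_cc_chain m n (M : 'M[bool]_(m, n)) c k :
  (randomized_cc R M <= c)%N -> chain (fun x y => M x y) k ->
  (k <= bisect_length (9 * 4 ^ c).+1)%N.
Proof.
rewrite /randomized_cc; case: ex_minnP => r /asboolP[Omega [mu [P [mu0 mu1 Pr PM]]]] _ rc.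
apply: randomized_chain; exists Omega, mu, P; split=> // w.
exact: leq_trans rc.
Qed.

End Perceptron.

Lemma chain_of_has_chain (V : finType) (e : rel V) k : symmetric e ->
  has_chain e k -> chain e k.
Proof.
move=> esym /existsP[a /existsP[b /andP[_ /forallP h]]].
exists (zip a b); first by rewrite size_zip !size_tuple minnn.
case: k a b h => [|k] a b h; first by rewrite (_ : zip a b = [::]) //; apply: size0nil; rewrite size_zip !size_tuple.
pose x0 := tnth a ord0; apply/(pairwiseP (x0, x0)) => i j.
rewrite !inE size_zip !size_tuple minnn => ik jk ij.
have /forallP/(_ (Ordinal jk)) := h (Ordinal ik); rewrite /= ij /= => /andP[h1 h2].
rewrite /chain_rel !nth_zip ?size_tuple //=.
by rewrite !(tnth_nth x0) /= in h1 h2; rewrite h1 esym.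
Qed.

(** The first row is adjacent to all later columns and the last column to all earlier rows, so
    without the two ends all rows lie on one side and all columns on the other. If the sides are
    exchanged, transposing reverses the chain. *)
Lemma chain_biedge_inv m n (G : bigraph m n) k :
  chain (biedge G) k.+2 -> chain (fun x y => G x y) k.
Proof.
move=> [[//|u s] [sk] /= /andP[/allP us ps]].
case/lastP: s sk us ps => // s v; rewrite size_rcons => -[sk] us.
rewrite pairwise_rcons => /andP[/allP vs ps].
have uw w : w \in s -> biedge G u.1 w.2.
  move=> ws; have wr : w \in rcons s v by rewrite mem_rcons inE ws orbT.
  by have /andP[] := us w wr.
have wv w : w \in s -> biedge G w.1 v.2 by move=> /vs/andP[].
have uv : biedge G u.1 v.2.
  have vr : v \in rcons s v by rewrite mem_rcons mem_head.
  by have /andP[] := us v vr.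
case: u.1 v.2 uv uw wv => [x|y] [x'|y'] // _ uw wv.
  have [t tE] : exists t, s = [seq (inl z.1, inr z.2) | z <- t].
    elim: s {sk us ps vs} uw wv => [|w s IHs] uw wv; first by exists [::].
    have [z zs|z zs|t ->] := IHs; [by apply: uw; rewrite inE zs orbT|by apply: wv; rewrite inE zs orbT|].
    have := uw w (mem_head _ _); have := wv w (mem_head _ _).
    by case: w {uw wv} => [[a|a] [b|b]] // _ _; exists ((a, b) :: t).
  by exists t; [rewrite -sk tE size_map | rewrite tE pairwise_map in ps].
have [t tE] : exists t, s = [seq (inr z.2, inl z.1) | z <- t].
  elim: s {sk us ps vs} uw wv => [|w s IHs] uw wv; first by exists [::].
  have [z zs|z zs|t ->] := IHs; [by apply: uw; rewrite inE zs orbT|by apply: wv; rewrite inE zs orbT|].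
  have := uw w (mem_head _ _); have := wv w (mem_head _ _).
  by case: w {uw wv} => [[a|a] [b|b]] // _ _; exists ((b, a) :: t).
exists (rev t); first by rewrite size_rev -sk tE size_map.
by rewrite pairwise_rev; rewrite tE pairwise_map in ps.
Qed.

(** * From single graphs to classes *)

Section Classes.
Variable R : realType.

Definition eqc_class (C : graph_class) : Prop :=
  exists d, forall n (G : sgraph n), G \in C n -> eqc d (edge G).

Definition eqc_biclass (C : bigraph_class) : Prop :=
  exists d, forall m n (G : bigraph m n), G \in C m n -> eqc d (biedge G).

Lemma stable_eqc_class (C : graph_class) :
  unit_disk_class R C \/ class_sign_rank_le R C 3 -> stable C -> eqc_class C.
Proof.
move=> hC [k hk]; case: hC => hC.
  have [d Hd] := eqc_unit_disk_rel R k; exists d => n G GC.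
  by apply: Hd (hC n G GC) (hk n G GC); [apply: edge_sym | apply: edge_irr].
have [d Hd] := eqc_sign_rank R k; exists d => n G GC.
exact: Hd (hC n G GC) (hk n G GC).
Qed.

Lemma stable_eqc_biclass (C : bigraph_class) :
  biunit_disk_class R C \/ biclass_sign_rank_le R C 3 -> bistable C -> eqc_biclass C.
Proof.
move=> hC [k hk]; case: hC => hC.
  have [d Hd] := eqc_unit_disk_rel R k; exists d => m n G GC.
  by apply: Hd (hC m n G GC) (hk m n G GC); [apply: biedge_sym | apply: biedge_irr].
have [d Hd] := eqc_bisign_rank R k; exists d => m n G GC.
exact: Hd (hC m n G GC) (hk m n G GC).
Qed.

Lemma eqc_class_bounded (C : graph_class) :
  eqc_class C -> bounded_by_constant (class_randomized_cc R C).
Proof.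
move=> [d Hd]; exists (d * (3 * d).+2) => N; apply/bigmax_leqP => G GC.
by apply: randomized_cc_le; apply: Hd.
Qed.

Lemma eqc_biclass_bounded (C : bigraph_class) :
  eqc_biclass C -> bounded_by_constant (biclass_randomized_cc R C).
Proof.
move=> [d Hd]; exists (d * (3 * d).+2) => N; apply/bigmax_leqP => m _.
apply/bigmax_leqP => G GC; apply: randomized_cc_le.
exact: (eqc_comp inl inr (Hd _ _ G GC)).
Qed.

Lemma eqc_class_implicit (C : graph_class) :
  eqc_class C -> has_implicit_representation R C.
Proof.
move=> [d Hd]; have [D [c Dc]] := eqc_encodable R d; exists D, c => n G GC.
by apply: Dc; apply: Hd.
Qed.

Lemma eqc_biclass_implicit (C : bigraph_class) :
  eqc_biclass C -> bihas_implicit_representation R C.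
Proof.
move=> [d Hd]; have [D [c Dc]] := eqc_encodable R d; exists D, c => m n G GC.
by apply: Dc; apply: Hd.
Qed.

Lemma bounded_stable (C : graph_class) :
  bounded_by_constant (class_randomized_cc R C) -> stable C.
Proof.
move=> [c hc]; exists (bisect_length (9 * 4 ^ c).+1) => n G GC.
apply: chain_index_leP => k /(chain_of_has_chain (@edge_sym _ G)).
apply: (@randomized_cc_chain R _ _ (adj G)); apply: leq_trans (hc n).
by rewrite /class_randomized_cc (bigD1 G) //= leq_maxl.
Qed.

Lemma bounded_bistable (C : bigraph_class) :
  bounded_by_constant (biclass_randomized_cc R C) -> bistable C.
Proof.
move=> [c hc]; exists (bisect_length (9 * 4 ^ c).+1).+2 => m n G GC.
apply: chain_index_leP => -[|[|k]] // /(chain_of_has_chain (@biedge_sym _ _ G)).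
move=> /chain_biedge_inv; rewrite !ltnS.
apply: (@randomized_cc_chain R); apply: leq_trans (hc (m + n)).
have hm : m < (m + n).+1 by rewrite ltnS leq_addr.
rewrite /biclass_randomized_cc (bigD1 (Ordinal hm)) //=.
apply: leq_trans (leq_maxl _ _); rewrite addKn.
by rewrite (bigD1 G) //= leq_maxl.
Qed.

End Classes.

Theorem theorem1p2 (R : realType) :
  [/\ forall C : graph_class,
        unit_disk_class R C \/ class_sign_rank_le R C 3 ->
        (bounded_by_constant (class_randomized_cc R C) <-> stable C),
      forall C : graph_class,
        unit_disk_class R C -> stable C -> has_implicit_representation R C
    & forall C : graph_class,
        class_sign_rank_le R C 3 -> stable C -> has_implicit_representation R C]
  /\
  [/\ forall C : bigraph_class,
        biunit_disk_class R C \/ biclass_sign_rank_le R C 3 ->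
        (bounded_by_constant (biclass_randomized_cc R C) <-> bistable C),
      forall C : bigraph_class,
        biunit_disk_class R C -> bistable C -> bihas_implicit_representation R C
    & forall C : bigraph_class,
        biclass_sign_rank_le R C 3 -> bistable C ->
        bihas_implicit_representation R C].
Proof.
split; split=> [C hC|C hC st|C hC st].
- split=> [|st]; first exact: bounded_stable.
  exact: eqc_class_bounded (stable_eqc_class hC st).
- exact: eqc_class_implicit (stable_eqc_class (or_introl hC) st).
- exact: eqc_class_implicit (stable_eqc_class (or_intror hC) st).
- split=> [|st]; first exact: bounded_bistable.
  exact: eqc_biclass_bounded (stable_eqc_biclass hC st).
- exact: eqc_biclass_implicit (stable_eqc_biclass (or_introl hC) st).
- exact: eqc_biclass_implicit (stable_eqc_biclass (or_intror hC) st).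
Qed.
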